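(* Let $\Omega\subseteq\mathbb{H}$ be a non-empty circular domain. Given $f,g\in\mathcal{SR}(\Omega)$, the function $f\wedge_* g$ vanishes identically if and only if $f_v$ and $g_v$ are linearly dependent over $\mathcal{SR}_{\mathbb{R}}(\Omega)$, namely there exist $\alpha,\beta\in\mathcal{SR}_{\mathbb{R}}(\Omega)$ such that $\alpha f_v+\beta g_v\equiv0$ and either $\alpha\not\equiv0$ or $\beta\not\equiv0$.
   Context: $\mathbb{H}$ is the algebra of quaternions (with the Euclidean topology of $\mathbb{R}^4$), with conjugation $q\mapsto q^c$, and $\mathbb{S}=\{q\in\mathbb{H}: q^2=-1\}$. For $D\subseteq\mathbb{C}=\{\alpha+\imath\beta:\alpha,\beta\in\mathbb{R}\}$ invariant under complex conjugation, $\Omega_D=\{\alpha+\beta I:\alpha+\imath\beta\in D,\ I\in\mathbb{S}\}$; sets of this form are called circular, and a circular domain is a connected open circular subset of $\mathbb{H}$. A stem function is $F=F_1+\imath F_2:D\to\mathbb{H}\otimes_{\mathbb{R}}\mathbb{C}$ ($F_1,F_2$ $\mathbb{H}$-valued) with $F(\overline z)=\overline{F(z)}$, where $\overline{p+\imath q}=p-\imath q$. It induces the slice function $f=\mathcal{I}(F):\Omega_D\to\mathbb{H}$, $f(\alpha+\beta I)=F_1(\alpha+\imath\beta)+I F_2(\alpha+\imath\beta)$. On a circular domain $\Omega=\Omega_D$, $f=\mathcal I(F)$ is slice-regular if $F$ is holomorphic for the natural complex structures of $\mathbb{C}$ and $\mathbb{H}\otimes_{\mathbb{R}}\mathbb{C}$;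 $\mathcal{SR}(\Omega)$ is the set of slice-regular functions, and $\mathcal{SR}_{\mathbb{R}}(\Omega)$ is the subset of slice-preserving ones, i.e. those with $F_1,F_2$ real-valued. The $*$-product is $\mathcal I(F)*\mathcal I(G)=\mathcal I(FG)$, with $(p+\imath q)(p'+\imath q')=pp'-qq'+\imath(pq'+qp')$; if one factor is slice-preserving it is the pointwise product. For $f=\mathcal I(F_1+\imath F_2)\in\mathcal{SR}(\Omega)$: $f^c=\mathcal I(F_1^c+\imath F_2^c)$ and $f_v=\frac{f-f^c}{2}$. For $f,g\in\mathcal{SR}(\Omega)$: $f\wedge_* g=\frac{f*g-g*f}{2}$. *)

(* Defs.v *)
From HB Require Import structures.
From mathcomp Require Import all_boot all_order all_algebra.
From mathcomp Require Import all_classical all_reals all_analysis.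
From mathcomp Require Import complex ring lra.

Set Implicit Arguments.
Unset Strict Implicit.
Unset Printing Implicit Defensive.

Import numFieldNormedType.Exports.
Import Order.TTheory GRing.Theory Num.Theory.

Local Open Scope classical_set_scope.
Local Open Scope ring_scope.
Local Open Scope complex_scope.

(* The quaternions as row vectors (a, b, c, d) = a + b i + c j + d k, so that
   vector space structure, norm and (Euclidean) topology are those of R^4. *)
Definition quat (R : realType) := 'rV[R]_4.

HB.instance Definition _ (R : realType) := NormedModule.on (quat R).
HB.instance Definition _ (R : realType) := Pointed.on (quat R).

Section Quaternions.
Variable R : realType.
Implicit Types p q : quat R.

Definition mkq (a b c d : R) : quat R := \row_(k < 4) nth 0 [:: a; b; c; d] k.

Lemma mkq0 a b c d : mkq a b c d 0 0 = a. Proof. by rewrite mxE. Qed.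
Lemma mkq1 a b c d : mkq a b c d 0 1 = b. Proof. by rewrite mxE. Qed.
Lemma mkq2 a b c d : mkq a b c d 0 2 = c. Proof. by rewrite mxE. Qed.
Lemma mkq3 a b c d : mkq a b c d 0 3 = d. Proof. by rewrite mxE. Qed.
Definition mkqE := (mkq0, mkq1, mkq2, mkq3).

Lemma quatP p q :
  [/\ p 0 0 = q 0 0, p 0 1 = q 0 1, p 0 2 = q 0 2 & p 0 3 = q 0 3] <-> p = q.
Proof.
split=> [[e0 e1 e2 e3]|-> //]; apply/rowP => -[[|[|[|[|//]]]] lt4].
- by have -> : Ordinal lt4 = 0 by apply: val_inj.
- by have -> : Ordinal lt4 = 1 by apply: val_inj.
- by have -> : Ordinal lt4 = 2 by apply: val_inj.
- by have -> : Ordinal lt4 = 3 by apply: val_inj.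
Qed.

Lemma quatD p q k : (p + q : quat R) 0 k = p 0 k + q 0 k.
Proof. exact: mxE. Qed.
Lemma quatN p k : (- p : quat R) 0 k = - p 0 k.
Proof. exact: mxE. Qed.
Lemma quatZ a p k : (a *: p : quat R) 0 k = a * p 0 k.
Proof. exact: mxE. Qed.
Lemma quat0 k : (0 : quat R) 0 k = 0.
Proof. exact: mxE. Qed.

Definition qmul p q : quat R := mkq
  (p 0 0 * q 0 0 - p 0 1 * q 0 1 - p 0 2 * q 0 2 - p 0 3 * q 0 3)
  (p 0 0 * q 0 1 + p 0 1 * q 0 0 + p 0 2 * q 0 3 - p 0 3 * q 0 2)
  (p 0 0 * q 0 2 - p 0 1 * q 0 3 + p 0 2 * q 0 0 + p 0 3 * q 0 1)
  (p 0 0 * q 0 3 + p 0 1 * q 0 2 - p 0 2 * q 0 1 + p 0 3 * q 0 0).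

Definition qone : quat R := mkq 1 0 0 0.

Lemma qmulA : associative qmul.
Proof. by move=> p q r; apply/quatP; rewrite /qmul !mkqE; split; ring. Qed.
Lemma qmul1q : left_id qone qmul.
Proof. by move=> p; apply/quatP; rewrite /qmul !mkqE; split; ring. Qed.
Lemma qmulq1 : right_id qone qmul.
Proof. by move=> p; apply/quatP; rewrite /qmul !mkqE; split; ring. Qed.
Lemma qmulDl : left_distributive qmul +%R.
Proof.
by move=> p q r; apply/quatP; rewrite /qmul !(quatD, mkqE); split; ring.
Qed.
Lemma qmulDr : right_distributive qmul +%R.
Proof.
by move=> p q r; apply/quatP; rewrite /qmul !(quatD, mkqE); split; ring.
Qed.
Lemma qone_neq0 : qone != 0.
Proof.
apply/eqP => /quatP[]; rewrite mkqE quat0 => /eqP.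
by rewrite oner_eq0.
Qed.

HB.instance Definition _ := GRing.Zmodule_isNzRing.Build (quat R)
  qmulA qmul1q qmulq1 qmulDl qmulDr qone_neq0.

Lemma qscaleAl a p q : a *: (p * q) = a *: p * q.
Proof.
by apply/quatP; rewrite /GRing.mul /= /qmul !(quatZ, mkqE); split; ring.
Qed.
Lemma qscaleAr a p q : a *: (p * q) = p * (a *: q).
Proof.
by apply/quatP; rewrite /GRing.mul /= /qmul !(quatZ, mkqE); split; ring.
Qed.

HB.instance Definition _ := GRing.Lmodule_isLalgebra.Build R (quat R) qscaleAl.
HB.instance Definition _ := GRing.Lalgebra_isAlgebra.Build R (quat R) qscaleAr.

Definition qconj p : quat R := mkq (p 0 0) (- p 0 1) (- p 0 2) (- p 0 3).

End Quaternions.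

Section SliceFunctions.
Variable R : realType.
Implicit Types (D : set R[i]) (Omega : set (quat R)) (f g : quat R -> quat R).

Definition imag_units : set (quat R) := [set I | I * I = -1].

(* alpha + beta I, for z = alpha + i beta *)
Definition slice_point (z : R[i]) (I : quat R) : quat R :=
  (complex.Re z)%:A + complex.Im z *: I.

Definition conj_invariant D := forall z, D z -> D (z^*).

Definition circularization D : set (quat R) :=
  [set q | exists z I, [/\ D z, imag_units I & q = slice_point z I]].

Definition circular Omega :=
  exists D, conj_invariant D /\ Omega = circularization D.

Definition circular_domain Omega :=
  [/\ circular Omega, open Omega & connected Omega].

(* The pair (p, q) stands for p + i q in H (x)_R C; the componentwise product
   that the library puts on pairs is not the one of H (x)_R C. *)
Definition quatC : Type := (quat R * quat R)%type.

Definition mulC (u v : quatC) : quatC :=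
  (u.1 * v.1 - u.2 * v.2, u.1 * v.2 + u.2 * v.1).

Definition barC (u : quatC) : quatC := (u.1, - u.2).

Definition qconjC (u : quatC) : quatC := (qconj u.1, qconj u.2).

(* H (x)_R C = C^4 as complex vector spaces *)
Definition coordC (u : quatC) : 'rV[R[i]]_4 := \row_k (u.1 0 k +i* u.2 0 k).

Implicit Types F G : R[i] -> quatC.

Definition stem_function D F :=
  conj_invariant D /\ forall z, D z -> F (z^*) = barC (F z).

(* Complex differentiability at every point of D; [derivable] refers to a full
   neighbourhood of z, so this is holomorphy when D is open. *)
Definition holomorphic_on D F := forall z, D z ->
  derivable (fun w : R[i]^o => coordC (F w)) z 1.

Definition real_valued_on D F := forall z, D z ->
  exists a b : R, F z = (a%:A, b%:A).

(* The slice function induced by F. It is total, with unspecified values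
   outside the circularization of the domain of the stem function F; inside,
   the choice of z and I is immaterial, see [slice_funE]. *)
Definition slice_fun F : quat R -> quat R := fun q =>
  xget 0 [set p | exists z I,
    [/\ imag_units I, q = slice_point z I & p = (F z).1 + I * (F z).2]].

Definition induced_by Omega f D F :=
  [/\ stem_function D F, Omega = circularization D
    & forall q, Omega q -> f q = slice_fun F q].

Definition slice_regular Omega f :=
  exists D F, induced_by Omega f D F /\ holomorphic_on D F.

Definition slice_preserving_regular Omega f :=
  exists D F, [/\ induced_by Omega f D F, holomorphic_on D F
                & real_valued_on D F].

(* The stem function of f, unique on D by [induced_by_inj]; only its values on
   D influence the slice functions below on Omega. *)
Definition stem_of Omega f : R[i] -> quatC :=
  xget (fun=> (0, 0)) [set F | exists D, induced_by Omega f D F].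

Definition slice_conj Omega f := slice_fun (qconjC \o stem_of Omega f).

Definition slice_mul Omega f g :=
  slice_fun (fun z => mulC (stem_of Omega f z) (stem_of Omega g z)).

Definition slice_vec Omega f : quat R -> quat R := fun q =>
  2^-1 *: (f q - slice_conj Omega f q).

Definition slice_wedge Omega f g : quat R -> quat R := fun q =>
  2^-1 *: (slice_mul Omega f g q - slice_mul Omega g f q).

Definition vanishes_on Omega f := forall q, Omega q -> f q = 0.

Lemma imag_unitsP I : imag_units I <->
  I 0 0 = 0 /\ I 0 1 ^+ 2 + I 0 2 ^+ 2 + I 0 3 ^+ 2 = 1.
Proof.
split.
  move=> /quatP[]; rewrite /GRing.mul /= /GRing.one /= /qone !(quatN, mkqE).
  set a := I 0 0; set b := I 0 1; set c := I 0 2; set d := I 0 3.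
  move=> e0 e1 e2 e3.
  have a0 : a = 0.
    apply/eqP/negPn/negP => an0.
    have z x : 2 * a * x = 0 -> x = 0.
      by move=> /eqP; rewrite !mulf_eq0 (negPf an0) pnatr_eq0 => /eqP.
    have b0 : b = 0 by apply: z; lra.
    have c0 : c = 0 by apply: z; lra.
    have d0 : d = 0 by apply: z; lra.
    have := sqr_ge0 a; rewrite b0 c0 d0 in e0; rewrite expr2; lra.
  split=> //; rewrite a0 in e0; rewrite !expr2; apply: oppr_inj; rewrite -e0; ring.
case=> a0 n1; apply/quatP.
rewrite /GRing.mul /= /GRing.one /= /qone !(quatN, mkqE) a0.
move: n1; rewrite !expr2 => n1; split; lra.
Qed.

Lemma imag_unitsN I : imag_units I -> imag_units (- I).
Proof. by rewrite /imag_units /= mulrNN. Qed.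

Definition qi : quat R := mkq 0 1 0 0.

Lemma qi_imag_unit : imag_units qi.
Proof. by apply/imag_unitsP; rewrite !mkqE; split; ring. Qed.

Lemma slice_point_inj z w I J : imag_units I -> imag_units J ->
  slice_point z I = slice_point w J ->
  [\/ w = z /\ (J = I \/ complex.Im z = 0) | w = z^* /\ J = - I].
Proof.
case: z w => [a b] [a' b'] /imag_unitsP[I0 I1] /imag_unitsP[J0 J1].
move=> /quatP[]; rewrite /slice_point /= /GRing.one /= /qone.
rewrite !(quatD, quatZ, mkqE) I0 J0 => e0 e1 e2 e3.
have aa : a' = a by lra.
have {}e1 : b * I 0 1 = b' * J 0 1 by lra.
have {}e2 : b * I 0 2 = b' * J 0 2 by lra.
have {}e3 : b * I 0 3 = b' * J 0 3 by lra.
have bb : b ^+ 2 = b' ^+ 2.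
  rewrite -[LHS]mulr1 -[RHS]mulr1 -{1}I1 -J1 !mulrDr -!exprMn.
  by rewrite e1 e2 e3.
have [b0|bn0] := eqVneq b 0.
  left; split; last by right.
  by rewrite aa b0; move: bb => /eqP; rewrite b0 expr0n /= eq_sym sqrf_eq0 => /eqP->.
move/eqP: bb; rewrite eqf_sqr => /orP[/eqP eb|/eqP eb].
  left; split; first by rewrite aa eb.
  left; apply/quatP; split; first by rewrite I0 J0.
  - by apply: (mulfI bn0); rewrite e1 eb.
  - by apply: (mulfI bn0); rewrite e2 eb.
  - by apply: (mulfI bn0); rewrite e3 eb.
right; split; first by rewrite aa /= eb opprK.
apply/quatP; split; rewrite !quatN; first by rewrite I0 J0 oppr0.
- by apply: (mulfI bn0); rewrite mulrN e1 eb mulNr.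
- by apply: (mulfI bn0); rewrite mulrN e2 eb mulNr.
- by apply: (mulfI bn0); rewrite mulrN e3 eb mulNr.
Qed.

Lemma slice_funE D F z I : stem_function D F -> D z -> imag_units I ->
  slice_fun F (slice_point z I) = (F z).1 + I * (F z).2.
Proof.
move=> [Dc sF] Dz SI; rewrite /slice_fun; case: xgetP => [p -> |/(_ _)]; last first.
  by move=> /(_ ((F z).1 + I * (F z).2)) []; exists z, I.
move=> [w [J [SJ eIJ ->]]].
case: (slice_point_inj SI SJ eIJ) => [[-> [-> //|z0]]|[-> ->]].
  have /(congr1 snd) /= : F z = barC (F z).
    by rewrite -sF //; case: z z0 {Dz eIJ} => a b /= ->; rewrite oppr0.
  move=> /eqP; rewrite -addr_eq0 -mulr2n -scaler_nat scaler_eq0 pnatr_eq0 /=.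
  by move=> /eqP->; rewrite !mulr0.
by rewrite sF //= mulrNN.
Qed.

Lemma circularization_inj D D' : conj_invariant D -> conj_invariant D' ->
  circularization D = circularization D' -> D = D'.
Proof.
move=> cD cD' e; apply/seteqP; split=> z Dz.
- have : circularization D (slice_point z qi).
    by exists z, qi; split=> //; exact: qi_imag_unit.
  rewrite e => -[w [J [Dw SJ]]] /(slice_point_inj qi_imag_unit SJ).
  case=> -[ew _]; first by rewrite -ew.
  by have := cD' _ Dw; rewrite ew conjcK.
- have : circularization D' (slice_point z qi).
    by exists z, qi; split=> //; exact: qi_imag_unit.
  rewrite -e => -[w [J [Dw SJ]]] /(slice_point_inj qi_imag_unit SJ).
  case=> -[ew _]; first by rewrite -ew.
  by have := cD _ Dw; rewrite ew conjcK.
Qed.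

Lemma induced_by_inj Omega f D F D' F' :
  induced_by Omega f D F -> induced_by Omega f D' F' ->
  D = D' /\ {in D, F =1 F'}.
Proof.
move=> [sF eD fF] [sF' eD' fF'].
have eDD : D = D'.
  by apply: circularization_inj; [case: sF|case: sF'|rewrite -eD].
split=> // z; rewrite inE => Dz; subst D'.
have e I : imag_units I -> (F z).1 + I * (F z).2 = (F' z).1 + I * (F' z).2.
  move=> SI; rewrite -(slice_funE sF) // -(slice_funE sF') //.
  have Oz : Omega (slice_point z I) by rewrite eD; exists z, I.
  by rewrite -fF // -fF'.
have := e _ (imag_unitsN qi_imag_unit); have := e _ qi_imag_unit.
case: (F z) (F' z) => [p q] [p' q'] /= e1 e2.
rewrite !mulNr in e2.
have ep : p = p'.
  have : 2 *: p = 2 *: p'.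
    have -> : 2 *: p = (p + qi * q) + (p - qi * q).
      by rewrite addrACA subrr addr0 scaler_nat mulr2n.
    by rewrite e1 e2 addrACA subrr addr0 scaler_nat mulr2n.
  by apply: scalerI; rewrite pnatr_eq0.
rewrite ep in e1 *; congr pair; move/addrI: e1 => /(congr1 ( *%R qi)).
by rewrite !mulrA qi_imag_unit !mulN1r => /oppr_inj.
Qed.

Lemma stem_ofP Omega f D F : induced_by Omega f D F ->
  induced_by Omega f D (stem_of Omega f) /\ {in D, stem_of Omega f =1 F}.
Proof.
move=> fF.
have [D' fS] : exists D, induced_by Omega f D (stem_of Omega f).
  have : exists F, [set F | exists D, induced_by Omega f D F] F.
    by exists F, D.
  exact: xgetPex.
by have [? e] := induced_by_inj fS fF; subst D'; split.
Qed.

Lemma qconjN (p : quat R) : qconj (- p) = - qconj p.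
Proof. by apply/quatP; rewrite !(quatN, mkqE). Qed.

Lemma slice_conjE Omega f D F z I : induced_by Omega f D F ->
  D z -> imag_units I ->
  slice_conj Omega f (slice_point z I) = qconj (F z).1 + I * qconj (F z).2.
Proof.
move=> fF Dz SI; have [[sS _ _] e] := stem_ofP fF.
rewrite /slice_conj (@slice_funE D) //= ?e ?inE //.
split=> [|w Dw]; first by case: sS.
by case: sS => _ /(_ _ Dw) /= ->; rewrite /qconjC /barC /= qconjN.
Qed.

Lemma slice_mulE Omega f g D F G z I :
  induced_by Omega f D F -> induced_by Omega g D G ->
  D z -> imag_units I ->
  slice_mul Omega f g (slice_point z I) =
    (mulC (F z) (G z)).1 + I * (mulC (F z) (G z)).2.
Proof.
move=> fF gG Dz SI.
have [[sS _ _] eF] := stem_ofP fF; have [[sT _ _] eG] := stem_ofP gG.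
rewrite /slice_mul (@slice_funE D) //= ?eF ?eG ?inE //.
split=> [|w Dw]; first by case: sS.
case: sS sT => _ /(_ _ Dw) /= -> [_ /(_ _ Dw)] /= ->.
by rewrite /mulC /barC /= mulrNN mulrN mulNr opprD.
Qed.

End SliceFunctions.

(* Main.v *)
Require Import Defs.
From HB Require Import structures.
From mathcomp Require Import all_boot all_order all_algebra.
From mathcomp Require Import all_classical all_reals all_analysis.
From mathcomp Require Import complex ring lra.

(** Let [D] be the plane set whose circularization is [Omega], and let [F] and
    [G] be the stem functions of [f] and [g]. Their components along the basis
    of the quaternions are holomorphic functions on [D] with complex values,
    [F_0, .., F_3] and [G_0, .., G_3], that commute with conjugation. In these
    terms,
    - [f_v] and [g_v] have components [(F_1, F_2, F_3)] and [(G_1, G_2, G_3)];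
    - slice-preserving functions [alpha] and [beta] are holomorphic functions [a]
      and [b] that commute with conjugation, and [alpha f_v + beta g_v = 0] means
      [a F_k + b G_k = 0] for [k = 1, 2, 3] ([combination_vanishes]);
    - the wedge product is the cross product of [f_v] and [g_v]: it vanishes if
      and only if the minors [F_i G_j - F_j G_i] do ([mulC_comm],
      [slice_wedge_vanishes]).
    So the theorem says that two vectors of holomorphic functions are dependent
    if and only if their minors vanish ([minors_vanish_iff_dependent]). If they
    do, some [G_k] and [- F_k] are the coefficients of a dependence relation.
    Conversely a relation kills the product of every minor with [a] and with
    [b]; that the minors themselves vanish is the absence of zero divisors among
    the holomorphic functions, that is, the identity theorem
    ([identity_on_circular]).

    The identity theorem is needed for functions that are complex differentiable
    at every point, with no continuity assumed of the derivative, and it is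
    proved without Cauchy's formula. Goursat's bisection argument
    ([closed_form_exact]) gives a primitive [phi + i psi] of [u + i v] on a
    square. The primitive is twice differentiable, which opens the way to a
    maximum principle that uses nothing but the second derivative test: the
    ratio of [phi ^+ 2 + psi ^+ 2] to a function whose logarithm is strictly
    superharmonic has no interior maximum ([no_touching_from_above]). If the
    primitive vanishes near the origin, comparison with high powers of
    [s * (L - s)], where [s = x ^+ 2 + y ^+ 2], shows that it vanishes on a disc
    whose radius depends only on the size of the square ([vanishing_square]).
    This local statement spreads to all of [Omega] because [Omega] is
    connected. *)

Set Implicit Arguments.
Unset Strict Implicit.
Unset Printing Implicit Defensive.

Import numFieldNormedType.Exports.
Import Order.TTheory GRing.Theory Num.Theory.

Local Open Scope classical_set_scope.
Local Open Scope ring_scope.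

(** * Functions of one real variable *)

Section OneVariable.
Variable R : realType.
Implicit Types (r x a b : R) (h H : R -> R).

Lemma is_derive1_eps h x l :
  (forall e, 0 < e -> exists d, 0 < d /\ forall s, `|s - x| < d ->
     `|h s - h x - l * (s - x)| <= e * `|s - x|) -> is_derive x 1 h l.
Proof.
move=> hl.
have cv : u^-1 *: ((h \o shift x) (u *: 1) - h x) @[u --> 0^'] --> l.
  apply/cvgrPdist_le => e e0; have [d [d0 hd]] := hl e e0.
  near=> u.
  have u0 : u != 0 by near: u; exact: nbhs_dnbhs_neq.
  have := hd (u + x); rewrite addrK => /(_ _)/le_trans H1.
  rewrite /= /shift /= -[X in X <= _](mulfK (x := `|u|)) ?normr_eq0//.
  rewrite ler_pdivrMr ?normr_gt0// -normrM.
  set q := _ *: _.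
  have -> : (l - q) * u = - (h (u + x) - h x - l * u).
    rewrite mulrBl /q /GRing.scale /= !mulr1 mulrAC mulVf// mul1r; ring.
  rewrite normrN; apply: H1 => //.
  by near: u; apply: dnbhs0_lt.
split; first by apply/cvg_ex; exists l.
exact: cvg_lim cv.
Unshelve. all: by end_near.
Qed.

Lemma primitive_exists r h : (forall x, `|x| <= r -> {for x, continuous h}) ->
  exists H, H 0 = 0 /\ forall x, `|x| < r -> is_derive x 1 H (h x).
Proof.
move=> hc.
pose I x := (\int[lebesgue_measure]_(t in `[- r, x]) h t)%R.
exists (fun x => I x - I 0); split; first exact: subrr.
move=> x; rewrite ltr_norml => /andP[rx xr].
have int : lebesgue_measure.-integrable `[- r, r] (EFin \o h).
  apply: continuous_compact_integrable; first exact: segment_compact.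
  apply: continuous_in_subspaceT => z; rewrite inE /= in_itv /= => zr.
  by apply: hc; rewrite ler_norml.
have [|dI eI] := continuous_FTC1_closed xr int rx.
  by apply: hc; rewrite ler_norml !ltW.
have dI' : is_derive x 1 I (h x).
  by split; [exact: dI | rewrite -derive1E; exact: eI].
by rewrite -[h x]subr0; apply: is_deriveB.
Qed.

(** The endpoints come in either order, so that increments along the edges of a
    rectangle need no case distinction on its orientation. *)
Lemma mvt_sym r h H a b : (forall x, `|x| < r -> is_derive x 1 H (h x)) ->
  `|a| < r -> `|b| < r ->
  exists c, (a <= c <= b \/ b <= c <= a) /\ H b - H a = h c * (b - a).
Proof.
move=> dH.
have main a' b' : a' <= b' -> `|a'| < r -> `|b'| < r ->
    exists c, a' <= c <= b' /\ H b' - H a' = h c * (b' - a').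
  move=> ab; rewrite !ltr_norml => /andP[a1 a2] /andP[b1 b2].
  have inr x : x \in `[a', b'] -> `|x| < r.
    rewrite in_itv /= => /andP[ax xb]; rewrite ltr_norml.
    by rewrite (lt_le_trans a1 ax) (le_lt_trans xb b2).
  have [||c] := @MVT_segment R H h a' b' ab.
  - by move=> x /subset_itv_oo_cc /inr; exact: dH.
  - by apply: derivable_within_continuous => x /inr /dH [].
  by rewrite in_itv /= => cab e; exists c.
move=> ar br; have [ab|/ltW ba] := leP a b.
  by have [c [cab e]] := main _ _ ab ar br; exists c; split=> //; left.
have [c [cab e]] := main _ _ ba br ar; exists c; split; first by right.
by rewrite -opprB e -mulrN opprB.
Qed.

Lemma derive0_cst r H : (forall x, `|x| < r -> is_derive x 1 H 0) ->
  forall a b, `|a| < r -> `|b| < r -> H a = H b.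
Proof.
move=> dH a b ar br; have [c [_ e]] := mvt_sym dH br ar.
by apply/eqP; rewrite -subr_eq0 e mul0r.
Qed.

(** The increment of [H] is the integral of [h] over the segment from [m - w] to
    [m + w], and [2 * w * (al + be * (m - t))] is that of the affine function
    [al + be * (x - t)]: a uniform bound on [h] minus this function gives one on
    the difference of the integrals. *)
Lemma primitive_affine_error r h H m w t al be e :
  (forall x, `|x| < r -> is_derive x 1 H (h x)) ->
  `|m - w| < r -> `|m + w| < r ->
  (forall x, `|x - m| <= `|w| -> `|h x - al - be * (x - t)| <= e) ->
  `|H (m + w) - H (m - w) - 2 * w * (al + be * (m - t))| <= 2 * `|w| * e.
Proof.
move=> dH m1 m2 he.
(* A primitive of the affine function; the mean value theorem applies to [H - A]. *)
pose A x := al * x + be / 2 * (x - t) ^+ 2.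
have dA x : `|x| < r -> is_derive x 1 (H - A) (h x - al - be * (x - t)).
  move=> /dH dx; rewrite -addrA -opprD; apply: is_deriveB.
  rewrite /A; apply: is_derive_eq.
  by rewrite /= /GRing.scale /=; field.
have [c [cm e1]] := mvt_sym dA m1 m2.
have -> : H (m + w) - H (m - w) - 2 * w * (al + be * (m - t)) =
    (H - A) (m + w) - (H - A) (m - w).
  by rewrite !fctE /A; field.
rewrite e1 normrM.
have -> : m + w - (m - w) = 2 * w by ring.
rewrite normrM (@ger0_norm _ 2)// mulrC; apply: ler_wpM2l.
  by rewrite mulr_ge0.
apply: he; rewrite ler_norml; case: cm => /andP[c1 c2].
  have w0 : 0 <= w by lra.
  by rewrite ger0_norm//; apply/andP; split; lra.
have w0 : w <= 0 by lra.
by rewrite ler0_norm//; apply/andP; split; lra.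
Qed.

(** If [l] were positive then [h1], which vanishes at [x], would be positive just
    to the right of [x], and [h] would increase there. *)
Lemma local_max_derive2 h h1 x d l : 0 < d ->
  (forall s, `|s - x| < d -> is_derive s 1 h (h1 s)) ->
  is_derive x 1 h1 l ->
  (forall s, `|s - x| < d -> h s <= h x) -> h1 x = 0 /\ l <= 0.
Proof.
move=> d0 dh dh1 hx.
have near_x c y : `|y - x| < d -> (x <= c <= y \/ y <= c <= x) -> `|c - x| < d.
  rewrite !ltr_norml => /andP[y1 y2] cxy.
  by apply/andP; split; case: cxy => /andP[? ?]; lra.
have h10 : h1 x = 0.
  have xin : x \in `](x - d), (x + d)[.
    by rewrite in_itv /=; apply/andP; split; lra.
  have := @derive1_at_max R h (x - d) (x + d) x _ _ xin _.
  have dx : is_derive x 1 h (h1 x) by apply: dh; rewrite subrr normr0.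
  have inb s : s \in `](x - d), (x + d)[ -> `|s - x| < d.
    by rewrite in_itv /= ltr_norml => /andP[? ?]; apply/andP; split; lra.
  case=> [|s /inb /dh []//|s /inb /hx //|_ e].
    lra.
  by case: dx => _ <-.
split=> //; rewrite leNgt; apply/negP => l0.
have [d' [d'0 h1pos]] : exists d', 0 < d' /\
    forall s, `|s - x| < d' -> x < s -> 0 < h1 s.
  have [dv ev] := dh1.
  move/cvg_ex : (dv) => [l' cl'].
  have ll' : l' = l by rewrite -ev; apply/esym/cvg_lim.
  move: cl'; rewrite ll' => /cvgrPdist_lt /(_ _ l0) [d' /= d'0 hd'].
  exists d'; split=> // s sd xs.
  have sx0 : 0 < s - x by rewrite subr_gt0.
  have := hd' (s - x); rewrite /= sub0r normrN => /(_ sd).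
  rewrite gt_eqF// => /(_ isT).
  rewrite /shift /= /GRing.scale /= mulr1 subrK h10 subr0 ltr_norml => /andP[_].
  rewrite ltrBlDl ltrDr pmulr_rgt0 ?invr_gt0//.
pose s := x + Num.min d d' / 2.
have m0 : 0 < Num.min d d' by rewrite lt_min d0.
have sx : `|s - x| < Num.min d d'.
  by rewrite /s addrC addKr ger0_norm; lra.
have xs : x < s by rewrite /s ltrDl; lra.
have sd : `|s - x| < d by apply: lt_le_trans sx _; rewrite ge_min lexx.
have xsc : {within `[x, s], continuous h}.
  apply: derivable_within_continuous => c; rewrite in_itv /= => cxs.
  by have [] := dh c (near_x c s sd (or_introl cxs)).
have [c|c] := @MVT R h h1 x s xs _ xsc.
  rewrite in_itv /= => /andP[c1 c2]; apply/dh/(near_x c s sd); left.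
  by rewrite !ltW.
rewrite in_itv /= => /andP[c1 c2] e.
have c0 : 0 < h1 c.
  apply: h1pos => //; apply: lt_le_trans (_ : Num.min d d' <= _).
    apply: le_lt_trans sx; rewrite !ger0_norm; lra.
  by rewrite ge_min lexx orbT.
have := hx s sd; rewrite -subr_le0 e leNgt pmulr_lgt0 ?c0//.
lra.
Qed.

End OneVariable.

(** * Differentiability in the plane, and bisection *)

Section TwoVariables.
Variable R : realType.
Implicit Types (P Q : R -> R -> R) (x y r : R).

Definition has_diff P x y px py := forall e, 0 < e ->
  exists d, 0 < d /\ forall s t, `|s - x| < d -> `|t - y| < d ->
    `|P s t - P x y - px * (s - x) - py * (t - y)| <= e * (`|s - x| + `|t - y|).

Lemma has_diff_derivx P x y px py :
  has_diff P x y px py -> is_derive x 1 (P^~ y) px.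
Proof.
move=> dP; apply: is_derive1_eps => e /dP [d [d0 hd]]; exists d; split=> // s sd.
have := hd s y sd; rewrite subrr normr0 mulr0 subr0 addr0; exact.
Qed.

Lemma has_diff_derivy P x y px py :
  has_diff P x y px py -> is_derive y 1 (P x) py.
Proof.
move=> dP; apply: is_derive1_eps => e /dP [d [d0 hd]]; exists d; split=> // t td.
have := hd x t; rewrite subrr normr0 mulr0 subr0 add0r => /(_ d0 td); exact.
Qed.

Lemma has_diffN P x y px py :
  has_diff P x y px py -> has_diff (fun s t => - P s t) x y (- px) (- py).
Proof.
move=> dP e /dP [d [d0 hd]]; exists d; split=> // s t sd td.
have := hd s t sd td; rewrite -normrN; congr (`|_| <= _); ring.
Qed.

Lemma has_diff_cont P x y px py : has_diff P x y px py ->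
  forall e, 0 < e -> exists d, 0 < d /\
    forall s t, `|s - x| < d -> `|t - y| < d -> `|P s t - P x y| <= e.
Proof.
move=> /(_ 1 ltr01) [d [d0 hd]] e e0.
pose K := 1 + `|px| + `|py|.
have K1 : 1 <= K by rewrite /K; have := normr_ge0 px; have := normr_ge0 py; lra.
have K0 : 0 < K by lra.
exists (Num.min d (e / (2 * K))); split.
  by rewrite lt_min d0 divr_gt0// mulr_gt0.
move=> s t; rewrite !lt_min => /andP[sd se] /andP[td te].
have := hd s t sd td; rewrite mul1r => h1.
have h2 : `|px * (s - x)| <= `|px| * (`|s - x| + `|t - y|).
  by rewrite normrM ler_wpM2l// lerDl.
have h3 : `|py * (t - y)| <= `|py| * (`|s - x| + `|t - y|).
  by rewrite normrM ler_wpM2l// lerDr.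
have -> : P s t - P x y = (P s t - P x y - px * (s - x) - py * (t - y))
    + px * (s - x) + py * (t - y) by ring.
apply: (le_trans (ler_normD _ _)).
apply: (le_trans (lerD (ler_normD _ _) (lexx _))).
apply: (@le_trans _ _ (K * (`|s - x| + `|t - y|))); first by rewrite /K; lra.
have -> : e = K * (e / (2 * K) + e / (2 * K)) by field; rewrite gt_eqF.
by rewrite ler_wpM2l ?(ltW K0)// lerD// ltW.
Qed.

(** The segments of centre [u n] and half-length [c / 2 ^+ n] are nested; the
    limit is the supremum of their left ends. *)
Lemma halving_limit (c : R) (u : nat -> R) :
  (forall n, `|u n.+1 - u n| <= c / 2 ^+ n.+1) ->
  exists l, forall n, `|l - u n| <= c / 2 ^+ n.
Proof.
move=> du.
pose lo n := u n - c / 2 ^+ n; pose hi n := u n + c / 2 ^+ n.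
have half n : c / 2 ^+ n = 2 * (c / 2 ^+ n.+1).
  by rewrite exprS; field; rewrite expf_neq0.
have loS n : lo n <= lo n.+1.
  by move: (du n); rewrite /lo (half n) ler_norml => /andP[? ?]; lra.
have hiS n : hi n.+1 <= hi n.
  by move: (du n); rewrite /hi (half n) ler_norml => /andP[? ?]; lra.
have lo_mono : {homo lo : m n / (m <= n)%N >-> m <= n}.
  exact: homo_leq (@lexx _ R) (@le_trans _ R) loS.
have hi_mono : {homo hi : m n / (m <= n)%N >-> n <= m}.
  by apply: homo_leq (@lexx _ R) _ hiS => a b d /[swap]; exact: le_trans.
have lohi n : lo n <= hi n.
  have : 0 <= c / 2 ^+ n.
    by rewrite half; have := le_trans (normr_ge0 _) (du n); lra.
  by rewrite /lo /hi; lra.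
have lub m : ubound (range lo) (hi m).
  move=> _ [n _ <-]; have [nm|/ltnW mn] := leqP n m.
    exact: le_trans (lo_mono _ _ nm) (lohi m).
  exact: le_trans (lohi n) (hi_mono _ _ mn).
exists (sup (range lo)) => n.
have s1 : lo n <= sup (range lo).
  by apply: ub_le_sup; [exists (hi 0%N); exact: lub | exists n].
have s2 : sup (range lo) <= hi n.
  by apply: ge_sup => //; exists (lo 0%N), 0%N.
by rewrite ler_norml; move: s1 s2; rewrite /lo /hi => ? ?; apply/andP; split; lra.
Qed.

(** If [Bad] passes from a rectangle to one of its quarters, then bad rectangles
    shrink to a point. Here [Bad n x y] is about the rectangle with centre
    [(x, y)] and half-sides [w / 2 ^+ n] and [h / 2 ^+ n]; the quarter is chosen
    by the signs of the displacement of its centre. The last two bounds say that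
    the rectangles stay inside the initial one. *)
Lemma bisection (Bad : nat -> R -> R -> Prop) (w h x0 y0 : R) :
  Bad 0%N x0 y0 ->
  (forall n x y, Bad n x y -> exists i j : bool,
     Bad n.+1 (x + (-1) ^+ i * (w / 2 ^+ n.+1)) (y + (-1) ^+ j * (h / 2 ^+ n.+1))) ->
  exists X Y, forall n, exists x y, [/\ Bad n x y,
    `|X - x| <= `|w| / 2 ^+ n, `|Y - y| <= `|h| / 2 ^+ n,
    `|x - x0| + `|w| / 2 ^+ n <= `|w| & `|y - y0| + `|h| / 2 ^+ n <= `|h|].
Proof.
move=> B0 BS.
pose Step (p : nat * (R * R)) (b : bool * bool) := Bad p.1 p.2.1 p.2.2 ->
  Bad p.1.+1 (p.2.1 + (-1) ^+ b.1 * (w / 2 ^+ p.1.+1))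
             (p.2.2 + (-1) ^+ b.2 * (h / 2 ^+ p.1.+1)).
have [g gP] : {g & forall p, Step p (g p)}.
  apply: choice => -[n [x y]].
  have [/BS [i [j b]]|nb] := pselect (Bad n x y).
    by exists (i, j).
  by exists (true, true) => /nb.
pose u := fix u n := if n is m.+1 then
  ((u m).1 + (-1) ^+ (g (m, u m)).1 * (w / 2 ^+ n),
   (u m).2 + (-1) ^+ (g (m, u m)).2 * (h / 2 ^+ n)) else (x0, y0).
have Bu n : Bad n (u n).1 (u n).2.
  elim: n => [//|n IH]; exact: (gP (n, u n) IH).
have step (i : bool) (a c : R) n :
    `|a + (-1) ^+ i * (c / 2 ^+ n.+1) - a| = `|c| / 2 ^+ n.+1.
  by rewrite addrC addKr normrM normr_sign mul1r normrM normfV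
    (@ger0_norm _ (2 ^+ _)) ?exprn_ge0.
have [n|X hX] := @halving_limit `|w| (fst \o u); first by rewrite /= step.
have [n|Y hY] := @halving_limit `|h| (snd \o u); first by rewrite /= step.
have inside (c : R) (v : nat -> R) :
    (forall n, `|v n.+1 - v n| = `|c| / 2 ^+ n.+1) ->
    forall n, `|v n - v 0%N| + `|c| / 2 ^+ n <= `|c|.
  move=> hv; elim=> [|n IH]; first by rewrite subrr normr0 add0r expr0 divr1.
  apply: le_trans IH.
  have -> : `|c| / 2 ^+ n = `|c| / 2 ^+ n.+1 + `|c| / 2 ^+ n.+1.
    by rewrite exprS; field; rewrite expf_neq0.
  rewrite addrA lerD2r -hv.
  have -> : v n.+1 - v 0%N = (v n - v 0%N) + (v n.+1 - v n) by ring.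
  exact: ler_normD.
exists X, Y => n; exists (u n).1, (u n).2; split=> //; first exact: hX.
- exact: hY.
- by have /= := inside w (fun m => (u m).1); apply=> m; rewrite step.
- by have /= := inside h (fun m => (u m).2); apply=> m; rewrite step.
Qed.

End TwoVariables.

(** * Goursat's theorem for closed differential forms *)

Section Goursat.
Variable R : realType.
Variables (P Q : R -> R -> R) (r : R).
Implicit Types x y w h : R.
Hypothesis closedPQ : forall x y, `|x| <= r -> `|y| <= r ->
  exists px c qy : R, has_diff P x y px c /\ has_diff Q x y c qy.

(** [A y] integrates [P dx] along horizontal segments at height [y], and [B x]
    integrates [Q dy] along vertical ones at abscissa [x], both from the
    coordinate axes. *)
Lemma edge_primitives : exists A B : R -> R -> R,
  (forall y, `|y| < r -> A y 0 = 0 /\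
     forall x, `|x| < r -> is_derive x 1 (A y) (P x y)) /\
  (forall x, `|x| < r -> B x 0 = 0 /\
     forall y, `|y| < r -> is_derive y 1 (B x) (Q x y)).
Proof.
have [A hA] : {A : R -> R -> R & forall y, `|y| < r -> A y 0 = 0 /\
     forall x, `|x| < r -> is_derive x 1 (A y) (P x y)}.
  apply: (@choice _ _ (fun y (H : R -> R) => `|y| < r -> H 0 = 0 /\
     forall x, `|x| < r -> is_derive x 1 H (P x y))) => y.
  have [yr|] := pselect (`|y| < r); last by exists (fun=> 0).
  have [x xr|H [H0 dH]] := @primitive_exists R r (P^~ y); last by exists H.
  have [px [c [qy [dP _]]]] := closedPQ xr (ltW yr).
  have [/derivable1_diffP dx _] := has_diff_derivx dP.
  exact: differentiable_continuous.
have [B hB] : {B : R -> R -> R & forall x, `|x| < r -> B x 0 = 0 /\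
     forall y, `|y| < r -> is_derive y 1 (B x) (Q x y)}.
  apply: (@choice _ _ (fun x (H : R -> R) => `|x| < r -> H 0 = 0 /\
     forall y, `|y| < r -> is_derive y 1 H (Q x y))) => x.
  have [xr|] := pselect (`|x| < r); last by exists (fun=> 0).
  have [y yr|H [H0 dH]] := @primitive_exists R r (Q x); last by exists H.
  have [px [c [qy [_ dQ]]]] := closedPQ (ltW xr) yr.
  have [/derivable1_diffP dy _] := has_diff_derivy dQ.
  exact: differentiable_continuous.
by exists A, B.
Qed.

Variables A B : R -> R -> R.
Hypothesis dA : forall y, `|y| < r ->
  forall x, `|x| < r -> is_derive x 1 (A y) (P x y).
Hypothesis dB : forall x, `|x| < r ->
  forall y, `|y| < r -> is_derive y 1 (B x) (Q x y).

(** The integral of [P dx + Q dy] along the boundary of the rectangle with centre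
    [(x, y)] and half-sides [w] and [h]. *)
Let E x y w h := A (y - h) (x + w) - A (y - h) (x - w)
  + (B (x + w) (y + h) - B (x + w) (y - h))
  - (A (y + h) (x + w) - A (y + h) (x - w))
  - (B (x - w) (y + h) - B (x - w) (y - h)).

Let E_quarters x y w h : E x y w h =
  (E (x + w / 2) (y + h / 2) (w / 2) (h / 2) + E (x + w / 2) (y - h / 2) (w / 2) (h / 2))
  + (E (x - w / 2) (y + h / 2) (w / 2) (h / 2) + E (x - w / 2) (y - h / 2) (w / 2) (h / 2)).
Proof.
have e1 (a c : R) : a + c / 2 + c / 2 = a + c by field.
have e2 (a c : R) : a + c / 2 - c / 2 = a by field.
have e3 (a c : R) : a - c / 2 + c / 2 = a by field.
have e4 (a c : R) : a - c / 2 - c / 2 = a - c by field.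
rewrite /E !(e1, e2, e3, e4); ring.
Qed.

(** Goursat's argument. Were the circulation nonzero, of absolute value [k], some
    quarter of the rectangle would have circulation at least [k / 4], and so on:
    the circulation along the [n]-th rectangle would be at least [k / 4 ^+ n].
    These rectangles shrink to a point [(X, Y)], where [P] and [Q] are
    differentiable. The first order expansions there contribute nothing, the
    mixed derivatives being equal, and the remainders contribute at most a small
    multiple of the squared diameter, that is, of [1 / 4 ^+ n]. *)
Lemma circulation0 x y w h : `|x| + `|w| < r -> `|y| + `|h| < r -> E x y w h = 0.
Proof.
move=> xw yh; apply/eqP/negPn/negP => E0.
pose k : R := `|E x y w h|; have k0 : 0 < k by rewrite normr_gt0.
pose Bad n a b := k / 4 ^+ n <= `|E a b (w / 2 ^+ n) (h / 2 ^+ n)|.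
have [||X [Y XY]] := @bisection R Bad w h x y.
- by rewrite /Bad !expr0 !divr1.
- rewrite /Bad => n a b.
  have hf (c : R) : c / 2 ^+ n.+1 = c / 2 ^+ n / 2.
    by rewrite exprS; field; rewrite expf_neq0.
  rewrite !hf E_quarters; set w' := w / _; set h' := h / _ => kE.
  have k4 : k / 4 ^+ n = 4 * (k / 4 ^+ n.+1).
    by rewrite exprS; field; rewrite expf_neq0.
  apply: contrapT => no.
  have lt (i j : bool) : `|E (a + (-1) ^+ i * (w' / 2)) (b + (-1) ^+ j * (h' / 2))
      (w' / 2) (h' / 2)| < k / 4 ^+ n.+1.
    by rewrite ltNge; apply/negP => le; apply: no; exists i, j.
  have := lt true true; have := lt true false.
  have := lt false true; have := lt false false.
  rewrite !expr0 !expr1 !mul1r !mulN1r => l1 l2 l3 l4.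
  have := le_trans kE (ler_normD _ _).
  have := ler_normD (E (a + w' / 2) (b + h' / 2) (w' / 2) (h' / 2))
    (E (a + w' / 2) (b - h' / 2) (w' / 2) (h' / 2)).
  have := ler_normD (E (a - w' / 2) (b + h' / 2) (w' / 2) (h' / 2))
    (E (a - w' / 2) (b - h' / 2) (w' / 2) (h' / 2)).
  rewrite k4; lra.
have lt_r (u c v : R) : `|u| + `|c| < r -> `|v - u| <= `|c| -> `|v| < r.
  move=> uc vu; apply: le_lt_trans uc; rewrite -[X in `|X| <= _](subrK u) addrC.
  by apply: le_trans (ler_normD _ _) _; rewrite lerD2l.
have [x0 [y0 [_]]] := XY 0%N; rewrite expr0 !divr1 => Xx0 Yy0 xx0 yy0.
have ex0 : x0 = x by apply/eqP; rewrite -subr_eq0 -normr_le0; lra.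
have ey0 : y0 = y by apply/eqP; rewrite -subr_eq0 -normr_le0; lra.
move: Xx0 Yy0; rewrite ex0 ey0 => {ex0 ey0 xx0 yy0 x0 y0} Xx Yy.
have Xr := lt_r _ _ _ xw Xx; have Yr := lt_r _ _ _ yh Yy.
have [px [c [qy [dP dQ]]]] := closedPQ (ltW Xr) (ltW Yr).
pose s := `|w| + `|h|; have s0 : 0 <= s by rewrite addr_ge0.
(* The remainders will add up to at most [e * (8 * s ^+ 2) / 4 ^+ n]. *)
pose D := 8 * s ^+ 2 + 1.
have D0 : 0 < D by have := sqr_ge0 s; rewrite /D; lra.
pose e := k / D; have e0 : 0 < e by rewrite divr_gt0.
have [d1 [d10 hP]] := dP _ e0; have [d2 [d20 hQ]] := dQ _ e0.
pose d := Num.min d1 d2; have d0 : 0 < d by rewrite lt_min d10.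
have [n dn] : exists n, 2 * s / 2 ^+ n < d.
  have [n hn] : exists n : nat, 2 * s / d < n%:R.
    by exists (Num.truncn (2 * s / d)).+1; rewrite truncnS_gt.
  exists n; rewrite ltr_pdivrMr ?exprn_gt0// [d * _]mulrC -ltr_pdivrMr//.
  apply: lt_trans hn _; rewrite -natrX ltr_nat; exact: ltn_expl.
have [x' [y' []]] := XY n.
rewrite /Bad; set w' := w / _; set h' := h / _ => kE.
have nw : `|w| / 2 ^+ n = `|w'|.
  by rewrite normrM normfV (@ger0_norm _ (2 ^+ _)) ?exprn_ge0.
have nh : `|h| / 2 ^+ n = `|h'|.
  by rewrite normrM normfV (@ger0_norm _ (2 ^+ _)) ?exprn_ge0.
rewrite nw nh => Xx' Yy' xx' yy'.
have sn : 2 * s / 2 ^+ n = 2 * (`|w'| + `|h'|).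
  by rewrite -nw -nh /s; field; rewrite expf_neq0.
have near (u v c' : R) : `|u - v| <= `|c'| -> `|c'| <= `|w'| + `|h'| ->
    forall z, `|z - v| <= `|c'| -> `|z - u| <= 2 * `|c'| /\ `|z - u| < d.
  move=> uv c's z zv.
  have zu : `|z - u| <= 2 * `|c'|.
    by rewrite mulr_natl mulr2n (le_trans (ler_distD v _ _))// lerD// distrC.
  split=> //; apply: le_lt_trans zu _; apply: le_lt_trans dn.
  by rewrite sn ler_pM2l.
have nearX := near X x' w' Xx'; have nearY := near Y y' h' Yy'.
have /nearX {}nearX : `|w'| <= `|w'| + `|h'| by rewrite lerDl.
have /nearY {}nearY : `|h'| <= `|w'| + `|h'| by rewrite lerDr.
pose m := e * (2 * `|w'| + 2 * `|h'|).
have errP u v : `|u - x'| <= `|w'| -> `|v - y'| <= `|h'| ->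
    `|P u v - (P X Y + c * (v - Y)) - px * (u - X)| <= m.
  move=> /nearX [u1 u2] /nearY [v1 v2].
  have := hP u v; rewrite (lt_le_trans u2) ?ge_min ?lexx//.
  rewrite (lt_le_trans v2) ?ge_min ?lexx// => /(_ isT isT) le.
  apply: le_trans (_ : e * (`|u - X| + `|v - Y|) <= _); last first.
    by rewrite ler_pM2l// lerD.
  by apply: le_trans le; rewrite le_eqVlt; apply/orP; left; apply/eqP; congr (`|_|); ring.
have errQ u v : `|u - x'| <= `|w'| -> `|v - y'| <= `|h'| ->
    `|Q u v - (Q X Y + c * (u - X)) - qy * (v - Y)| <= m.
  move=> /nearX [u1 u2] /nearY [v1 v2].
  have := hQ u v; rewrite (lt_le_trans u2) ?ge_min ?lexx ?orbT//.
  rewrite (lt_le_trans v2) ?ge_min ?lexx ?orbT// => /(_ isT isT) le.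
  apply: le_trans (_ : e * (`|u - X| + `|v - Y|) <= _); last first.
    by rewrite ler_pM2l// lerD.
  by apply: le_trans le; rewrite le_eqVlt; apply/orP; left; apply/eqP; congr (`|_|); ring.
have ends (u c' : R) : `|u - c' - u| <= `|c'| /\ `|u + c' - u| <= `|c'|.
  by rewrite addrC addKr normrN addrC addKr.
have [xm xp] := ends x' w'; have [ym yp] := ends y' h'.
have inx u : `|u - x'| <= `|w'| -> `|u| < r.
  move=> ux; apply: (lt_r x w) => //.
  apply: le_trans (ler_distD x' _ _) _; apply: le_trans xx'.
  by rewrite addrC lerD2l.
have iny u : `|u - y'| <= `|h'| -> `|u| < r.
  move=> uy; apply: (lt_r y h) => //.
  apply: le_trans (ler_distD y' _ _) _; apply: le_trans yy'.
  by rewrite addrC lerD2l.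
have fA v : `|v - y'| <= `|h'| -> `|A v (x' + w') - A v (x' - w') -
    2 * w' * (P X Y + c * (v - Y) + px * (x' - X))| <= 2 * `|w'| * m.
  move=> vy; apply: (@primitive_affine_error R r (P^~ v)).
  - by move=> z zr; apply: dA => //; exact: iny.
  - exact: inx.
  - exact: inx.
  - by move=> z zx; exact: errP.
have fB u : `|u - x'| <= `|w'| -> `|B u (y' + h') - B u (y' - h') -
    2 * h' * (Q X Y + c * (u - X) + qy * (y' - Y))| <= 2 * `|h'| * m.
  move=> ux; apply: (@primitive_affine_error R r (Q u)).
  - by move=> z zr; apply: dB => //; exact: inx.
  - exact: iny.
  - exact: iny.
  - by move=> z zy; exact: errQ.
have {fA}[a1 a2] := (fA _ ym, fA _ yp).
have {fB}[b1 b2] := (fB _ xm, fB _ xp).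
have : `|E x' y' w' h'| <= 8 * e * (`|w'| + `|h'|) ^+ 2.
  apply: (@le_trans _ _ (2 * `|w'| * m + 2 * `|h'| * m + 2 * `|w'| * m + 2 * `|h'| * m)).
    have tri (p q u v p' q' u' v' z : R) : `|p| <= p' -> `|q| <= q' ->
        `|u| <= u' -> `|v| <= v' -> z = p + q - u - v ->
        `|z| <= p' + q' + u' + v'.
      move=> ? ? ? ? ->; apply: le_trans (ler_normB _ _) _; apply: lerD => //.
      apply: le_trans (ler_normB _ _) _; apply: lerD => //.
      by apply: le_trans (ler_normD _ _) _; apply: lerD.
    apply: (tri _ _ _ _ _ _ _ _ _ a1 b2 a2 b1).
    (* The integrals of the four affine approximations cancel, because [c] is
       both the derivative of [P] in [y] and that of [Q] in [x]. *)
    rewrite /E; ring.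
  by rewrite /m le_eqVlt; apply/orP; left; apply/eqP; ring.
move=> /(le_trans kE).
have -> : `|w'| + `|h'| = s / 2 ^+ n by rewrite -nw -nh /s mulrDl.
have -> : 4 ^+ n = 2 ^+ n * 2 ^+ n :> R by rewrite -exprMn -natrM.
rewrite ler_pdivrMr ?mulr_gt0 ?exprn_gt0//.
have -> : 8 * e * (s / 2 ^+ n) ^+ 2 * (2 ^+ n * 2 ^+ n) = e * (8 * s ^+ 2).
  by field; rewrite expf_neq0.
have -> : k = e * D by rewrite /e divfK// gt_eqF.
by rewrite ler_pM2l// /D -subr_ge0 opprD addNKr oppr_ge0 ler10.
Qed.

End Goursat.

(** The potential is the integral from the origin to [(x, y)], first vertically
    and then horizontally; this gives the derivative in [x]. As the circulation
    along rectangles vanishes, the other order gives the same function, hence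
    the derivative in [y]. *)
Lemma closed_form_exact (R : realType) (P Q : R -> R -> R) (r : R) : 0 < r ->
  (forall x y, `|x| <= r -> `|y| <= r ->
    exists px c qy : R, has_diff P x y px c /\ has_diff Q x y c qy) ->
  exists phi : R -> R -> R, phi 0 0 = 0 /\
    forall x y : R, `|x| < r -> `|y| < r ->
      is_derive x 1 (phi^~ y) (P x y) /\ is_derive y 1 (phi x) (Q x y).
Proof.
move=> r0; have rn : `|0 : R| < r by rewrite normr0.
move=> cl; have [A [B [hA hB]]] := edge_primitives cl.
exists (fun x y => A y x + B 0 y); split.
  by rewrite (hA _ rn).1 (hB _ rn).1 addr0.
move=> x y xr yr.
split.
  rewrite -[P x y]addr0.
  apply: (@is_deriveD _ _ _ (A y) (cst (B 0 y))); exact: (hA _ yr).2.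
have dA (v : R) : `|v| < r -> forall u : R, `|u| < r -> is_derive u 1 (A v) (P u v).
  by move=> vr; exact: (hA _ vr).2.
have dB (u : R) : `|u| < r -> forall v : R, `|v| < r -> is_derive v 1 (B u) (Q u v).
  by move=> ur; exact: (hB _ ur).2.
have eq (v : R) : `|v| < r -> A v x + B 0 v = A 0 x + B x v.
  move=> vr.
  have := @circulation0 _ _ _ _ cl _ _ dA dB (x / 2) (v / 2) (x / 2) (v / 2).
  have e1 (c : R) : c / 2 + c / 2 = c by field.
  have e2 (c : R) : `|c / 2| + `|c / 2| = `|c|.
    by rewrite normrM normfV (@ger0_norm _ 2)// e1.
  rewrite !e1 !subrr !e2 => /(_ xr vr).
  rewrite (hA _ rn).1 (hA _ vr).1 (hB _ rn).1 (hB _ xr).1; lra.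
apply: (@near_eq_is_derive _ _ _ (fun v => A 0 x + B x v)).
  have : (`|y| < r) by []; rewrite ltr_norml => /andP[ry yr'].
  near=> v; rewrite -eq// ltr_norml; apply/andP; split.
    by near: v; exact: lt_nbhsr.
  by near: v; exact: lt_nbhsl.
rewrite -[Q x y]add0r.
apply: (@is_deriveD _ _ _ (cst (A 0 x)) (B x)); exact: (hB _ xr).2.
Unshelve. all: by end_near.
Qed.

(** * A maximum principle for pairs of conjugate harmonic functions *)

Section UniqueContinuation.
Variable R : realType.
Implicit Types (P Q phi psi u v : R -> R -> R) (x y r d : R).

Definition cont2 P x y := forall e, 0 < e -> exists d, 0 < d /\
  forall s t, `|s - x| < d -> `|t - y| < d -> `|P s t - P x y| <= e.

Lemma cont2_cvg P x y : cont2 P x y ->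
  {for (x, y), continuous (fun z : R * R => P z.1 z.2)}.
Proof.
move=> cP; apply/cvgrPdist_le => e /cP [d [d0 hd]].
exists (ball x d, ball y d) => /=.
  by split; exact: nbhsx_ballx.
move=> [s t] [/= sx ty]; rewrite distrC; apply: hd; rewrite distrC; [exact: sx|exact: ty].
Qed.

Lemma C1_has_diff r phi P Q x y : `|x| < r -> `|y| < r ->
  (forall s t : R, `|s| < r -> `|t| < r ->
    is_derive s 1 (phi^~ t) (P s t) /\ is_derive t 1 (phi s) (Q s t)) ->
  cont2 P x y -> cont2 Q x y -> has_diff phi x y (P x y) (Q x y).
Proof.
move=> xr yr dphi cP cQ e e0.
have [d1 [d10 h1]] := cP _ e0; have [d2 [d20 h2]] := cQ _ e0.
exists (Num.min (Num.min d1 d2) (Num.min (r - `|x|) (r - `|y|))); split.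
  by rewrite !lt_min d10 d20 !subr_gt0 xr.
move=> s t; rewrite !lt_min => /andP[/andP[s1 s2] /andP[s3 _]].
move=> /andP[/andP[t1 t2] /andP[_ t4]].
have inr (a c : R) : `|c - a| < r - `|a| -> `|c| < r.
  rewrite ltrBrDr => h; apply: le_lt_trans h.
  by rewrite -{1}(subrK a c) ler_normD.
have sr := inr _ _ s3; have tr := inr _ _ t4.
have btw (a b c : R) : a <= c <= b \/ b <= c <= a -> `|c - a| <= `|b - a|.
  case=> /andP[ac cb].
    by rewrite !ger0_norm; lra.
  by rewrite !ler0_norm; lra.
have [c [/btw cx ec]] := mvt_sym (fun s' sr' => (dphi s' t sr' tr).1) xr sr.
have [c' [/btw cy ec']] := mvt_sym (fun t' tr' => (dphi x t' xr tr').2) yr tr.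
have -> : phi s t - phi x y - P x y * (s - x) - Q x y * (t - y) =
    (P c t - P x y) * (s - x) + (Q x c' - Q x y) * (t - y).
  have -> : phi s t - phi x y = (phi s t - phi x t) + (phi x t - phi x y) by ring.
  by rewrite ec ec'; ring.
rewrite [e * _]mulrDr; apply: le_trans (ler_normD _ _) _.
apply: lerD; rewrite normrM ler_wpM2r//.
  by apply: h1 => //; apply: le_lt_trans s1.
by apply: h2; [rewrite subrr normr0 | apply: le_lt_trans t2].
Qed.

(** In this section [u + i v] is holomorphic and [phi + i psi] is a primitive of
    it. The primitive is used rather than [u + i v] because it is twice
    differentiable without further work: its derivative is differentiable. *)
Section HarmonicPair.
Variables (u v phi psi : R -> R -> R) (r : R).
Hypothesis hol : forall x y, `|x| < r -> `|y| < r ->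
  exists p q : R, has_diff u x y p (- q) /\ has_diff v x y q p.
Hypothesis dphi : forall x y, `|x| < r -> `|y| < r ->
  is_derive x 1 (phi^~ y) (u x y) /\ is_derive y 1 (phi x) (- v x y).
Hypothesis dpsi : forall x y, `|x| < r -> `|y| < r ->
  is_derive x 1 (psi^~ y) (v x y) /\ is_derive y 1 (psi x) (u x y).

Let S x y := phi x y * phi x y + psi x y * psi x y.

(** At such a point [ln S - ln N] would be maximal, although [ln S] is harmonic,
    [S] being the square of the modulus of a holomorphic function, and [ln N] is
    strictly superharmonic, as the last hypothesis says. The proof avoids
    logarithms: the Laplacian of [S] is [4 * (u ^+ 2 + v ^+ 2)], and its product
    with [S] is the square of the gradient of [S]; the contact of [S] and [C N]
    makes the gradients equal and compares the Laplacians. *)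
Lemma no_touching_from_above (N : R -> R -> R) (Nx Ny : R -> R) Nxx Nyy C x y d :
  0 < d -> `|x| + d <= r -> `|y| + d <= r -> 0 < C -> 0 < N x y ->
  (forall s, `|s - x| < d -> is_derive s 1 (N^~ y) (Nx s)) ->
  is_derive x 1 Nx Nxx ->
  (forall t, `|t - y| < d -> is_derive t 1 (N x) (Ny t)) ->
  is_derive y 1 Ny Nyy ->
  S x y = C * N x y ->
  (forall s t, `|s - x| < d -> `|t - y| < d -> S s t <= C * N s t) ->
  N x y * (Nxx + Nyy) < Nx x ^+ 2 + Ny y ^+ 2 -> False.
Proof.
move=> d0 xd yd C0 N0 dNx dNxx dNy dNyy SN Sle superh.
have xr : `|x| < r by apply: lt_le_trans xd; rewrite ltrDl.
have yr : `|y| < r by apply: lt_le_trans yd; rewrite ltrDl.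
have inr (a c : R) : `|a| + d <= r -> `|c - a| < d -> `|c| < r.
  move=> ar ca; apply: lt_le_trans ar; rewrite -{1}(subrK a c).
  by apply: le_lt_trans (ler_normD _ _) _; rewrite addrC ltrD2l.
have [p [q [du dv]]] := hol xr yr.
have xx : `|x - x| < d by rewrite subrr normr0.
have yy : `|y - y| < d by rewrite subrr normr0.
have [e1 l1] : 2 * (phi x y * u x y + psi x y * v x y) - C * Nx x = 0 /\
    2 * (u x y ^+ 2 + v x y ^+ 2 + phi x y * p + psi x y * q) - C * Nxx <= 0.
  have d1 s : `|s - x| < d -> is_derive s 1 (fun s => S s y - C * N s y)
      (2 * (phi s y * u s y + psi s y * v s y) - C * Nx s).
    move=> sx; have sr := inr _ _ xd sx.
    have [dp _] := dphi sr yr; have [dq _] := dpsi sr yr.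
    have dn := dNx _ sx; rewrite /S; apply: is_derive_eq.
    by rewrite /GRing.scale /=; ring.
  have d2 : is_derive x 1
      (fun s => 2 * (phi s y * u s y + psi s y * v s y) - C * Nx s)
      (2 * (u x y ^+ 2 + v x y ^+ 2 + phi x y * p + psi x y * q) - C * Nxx).
    have [dp _] := dphi xr yr; have [dq _] := dpsi xr yr.
    have dux := has_diff_derivx du; have dvx := has_diff_derivx dv.
    by apply: is_derive_eq; rewrite /GRing.scale /=; ring.
  apply: (local_max_derive2 d0 d1 d2) => s sx.
  by rewrite SN subrr subr_le0; exact: Sle.
have [e2 l2] : 2 * (- (phi x y * v x y) + psi x y * u x y) - C * Ny y = 0 /\
    2 * (u x y ^+ 2 + v x y ^+ 2 - phi x y * p - psi x y * q) - C * Nyy <= 0.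
  have d1 t : `|t - y| < d -> is_derive t 1 (fun t => S x t - C * N x t)
      (2 * (- (phi x t * v x t) + psi x t * u x t) - C * Ny t).
    move=> ty; have tr := inr _ _ yd ty.
    have [_ dp] := dphi xr tr; have [_ dq] := dpsi xr tr.
    have dn := dNy _ ty; rewrite /S; apply: is_derive_eq.
    by rewrite /GRing.scale /=; ring.
  have d2 : is_derive y 1
      (fun t => 2 * (- (phi x t * v x t) + psi x t * u x t) - C * Ny t)
      (2 * (u x y ^+ 2 + v x y ^+ 2 - phi x y * p - psi x y * q) - C * Nyy).
    have [_ dp] := dphi xr yr; have [_ dq] := dpsi xr yr.
    have duy := has_diff_derivy du; have dvy := has_diff_derivy dv.
    by apply: is_derive_eq; rewrite /GRing.scale /=; ring.
  apply: (local_max_derive2 d0 d1 d2) => t ty.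
  by rewrite SN subrr subr_le0; exact: Sle.
have lap : 4 * (u x y ^+ 2 + v x y ^+ 2) <= C * (Nxx + Nyy) by lra.
have grad : C ^+ 2 * (Nx x ^+ 2 + Ny y ^+ 2) =
    S x y * (4 * (u x y ^+ 2 + v x y ^+ 2)).
  have n1 : C * Nx x = 2 * (phi x y * u x y + psi x y * v x y) by lra.
  have n2 : C * Ny y = 2 * (- (phi x y * v x y) + psi x y * u x y) by lra.
  by rewrite mulrDr -!exprMn n1 n2 /S; ring.
move: superh; rewrite ltNge => /negP; apply.
rewrite -(ler_pM2l (exprn_gt0 2 C0)) grad SN.
have -> : C ^+ 2 * (N x y * (Nxx + Nyy)) = C * N x y * (C * (Nxx + Nyy)) by ring.
by rewrite ler_pM2l// mulr_gt0.
Qed.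

End HarmonicPair.

End UniqueContinuation.

(** * The comparison function *)

Section Weight.
Variable R : realType.
Variable L : R.
Implicit Types x y : R.

(** With [s] the square of the distance to the origin, this is [s * (L - s)]: it
    vanishes only at the origin when [s < L], and increases with [s] up to
    [L / 2]. *)
Definition weight x y : R := L * (x ^+ 2 + y ^+ 2) - (x ^+ 2 + y ^+ 2) ^+ 2.

Lemma weightC x y : weight x y = weight y x.
Proof. by rewrite /weight [y ^+ 2 + _]addrC. Qed.

Definition weight_d x y : R := 2 * x * (L - 2 * (x ^+ 2 + y ^+ 2)).

Definition weight_dd x y : R := 2 * (L - 2 * (x ^+ 2 + y ^+ 2)) - 8 * x ^+ 2.

Lemma is_derive_weight x y : is_derive x 1 (weight^~ y) (weight_d x y).
Proof.
rewrite /weight; apply: is_derive_eq.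
by rewrite /weight_d /GRing.scale /=; ring.
Qed.

Lemma is_derive_weight_d x y : is_derive x 1 (weight_d^~ y) (weight_dd x y).
Proof.
rewrite /weight_d; apply: is_derive_eq.
by rewrite /weight_dd /GRing.scale /=; ring.
Qed.

Lemma is_derive_weightX n x y : is_derive x 1 (fun s => weight s y ^+ n.+1)
  (n.+1%:R * weight x y ^+ n * weight_d x y).
Proof.
have -> : (fun s => weight s y ^+ n.+1) = (weight^~ y) ^+ n.+1.
  by apply/funext => s; rewrite exprfctE.
exact: (is_deriveX n.+1 (is_derive_weight x y)).
Qed.

Lemma is_derive_weightX_d n x y :
  is_derive x 1 (fun s => n.+2%:R * weight s y ^+ n.+1 * weight_d s y)
  (n.+2%:R * (n.+1%:R * weight x y ^+ n * weight_d x y ^+ 2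
              + weight x y ^+ n.+1 * weight_dd x y)).
Proof.
have dw := is_derive_weightX n x y; have ddw := is_derive_weight_d x y.
have -> : (fun s => n.+2%:R * weight s y ^+ n.+1 * weight_d s y) =
    (fun s => n.+2%:R * (weight s y ^+ n.+1 * weight_d s y)).
  by apply/funext => s; rewrite -mulrA.
apply: (is_derive_eq (is_deriveZ n.+2%:R (is_deriveM dw ddw))).
by rewrite /GRing.scale /=; ring.
Qed.

(** Away from the origin, [ln weight] is the sum of the harmonic function
    [ln (x ^+ 2 + y ^+ 2)] and of the strictly superharmonic function
    [ln (L - (x ^+ 2 + y ^+ 2))]; so powers of [weight] have strictly
    superharmonic logarithms too. The derivatives in [y] are obtained from those
    in [x] by the symmetry of [weight]. *)
Lemma weightX_superharmonic n x y : 0 < L -> 0 < x ^+ 2 + y ^+ 2 -> 0 < weight x y ->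
  weight x y ^+ n.+2 *
    (n.+2%:R * (n.+1%:R * weight x y ^+ n * weight_d x y ^+ 2
       + weight x y ^+ n.+1 * weight_dd x y)
     + n.+2%:R * (n.+1%:R * weight y x ^+ n * weight_d y x ^+ 2
       + weight y x ^+ n.+1 * weight_dd y x))
  < (n.+2%:R * weight x y ^+ n.+1 * weight_d x y) ^+ 2
    + (n.+2%:R * weight y x ^+ n.+1 * weight_d y x) ^+ 2.
Proof.
move=> L0 s0 w0; rewrite -(weightC x y) -subr_lt0.
set w := weight x y in w0 *.
pose s := x ^+ 2 + y ^+ 2.
rewrite [X in X < 0](_ : _ = - (n.+2%:R * w ^+ n ^+ 2 * w ^+ 2 * (4 * L * s ^+ 2))).
  by rewrite oppr_lt0 !mulr_gt0// ?exprn_gt0// ltr0n.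
rewrite !exprS -[n.+2]addn1 -[n.+1]addn1 !natrD; set N := n%:R; set W := w ^+ n.
by rewrite /w /weight /weight_d /weight_dd /s; ring.
Qed.

End Weight.

Lemma norm_lt_sqr (R : realType) (a c : R) : 0 <= c -> a ^+ 2 < c ^+ 2 -> `|a| < c.
Proof. by move=> c0; rewrite -[a ^+ 2]real_normK ?num_real// ltr_pXn2r// nnegrE. Qed.

Lemma norm_le_sqr (R : realType) (a c : R) : 0 <= c -> a ^+ 2 <= c ^+ 2 -> `|a| <= c.
Proof. by move=> c0; rewrite -[a ^+ 2]real_normK ?num_real// ler_pXn2r// nnegrE. Qed.

Lemma square_max (R : realType) (rho : R) (h : R -> R -> R) : 0 <= rho ->
  (forall x y : R, `|x| <= rho -> `|y| <= rho ->
    {for (x, y), continuous (fun z : R * R => h z.1 z.2)}) ->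
  exists x y, [/\ `|x| <= rho, `|y| <= rho &
    forall s t : R, `|s| <= rho -> `|t| <= rho -> h s t <= h x y].
Proof.
move=> rho0 hc; pose K : set (R * R) := `[- rho, rho] `*` `[- rho, rho].
have inK (a b : R) : K (a, b) <-> `|a| <= rho /\ `|b| <= rho.
  by rewrite /K /setX /= !in_itv /= -!ler_norml.
have [||| [x y] /set_mem /inK [xr yr] max] :=
    @compact_EVT_max (R * R)%type R (fun z => h z.1 z.2) K.
- by exists (0, 0); apply/inK; rewrite normr0.
- by apply: compact_setX; exact: segment_compact.
- by apply: continuous_in_subspaceT => -[a b] /set_mem /inK [ar br]; exact: hc.
exists x, y; split=> // s t sr tr.
by apply: (max (s, t)); apply/mem_set/inK.
Qed.

(** * The identity theorem near a point *)

Section Vanishing.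
Variable R : realType.
Variables (u v phi psi : R -> R -> R) (r : R).
Implicit Types x y : R.
Hypothesis hol : forall x y, `|x| < r -> `|y| < r ->
  exists p q : R, has_diff u x y p (- q) /\ has_diff v x y q p.
Hypothesis dphi : forall x y, `|x| < r -> `|y| < r ->
  is_derive x 1 (phi^~ y) (u x y) /\ is_derive y 1 (phi x) (- v x y).
Hypothesis dpsi : forall x y, `|x| < r -> `|y| < r ->
  is_derive x 1 (psi^~ y) (v x y) /\ is_derive y 1 (psi x) (u x y).

Let S x y := phi x y * phi x y + psi x y * psi x y.

Let S_ge0 x y : 0 <= S x y.
Proof. by rewrite /S -!expr2 addr_ge0 ?sqr_ge0. Qed.

Let S_cont x y : `|x| < r -> `|y| < r ->
  {for (x, y), continuous (fun z : R * R => S z.1 z.2)}.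
Proof.
move=> xr yr; have [p [q [du dv]]] := hol xr yr.
have cu := has_diff_cont du; have cv := has_diff_cont dv.
have cnv := has_diff_cont (has_diffN dv).
have cphi := cont2_cvg (has_diff_cont (C1_has_diff xr yr dphi cu cnv)).
have cpsi := cont2_cvg (has_diff_cont (C1_has_diff xr yr dpsi cv cu)).
by apply: (@continuousD _ _ _ (fun z => phi z.1 z.2 * phi z.1 z.2)
  (fun z => psi z.1 z.2 * psi z.1 z.2)); exact: continuousM.
Qed.

Let weight_cont (L : R) : continuous (fun z : R * R => weight L z.1 z.2).
Proof.
move=> z; rewrite /weight.
have c1 : {for z, continuous (fst : R * R -> R)} by exact: cvg_fst.
have c2 : {for z, continuous (snd : R * R -> R)} by exact: cvg_snd.
have cs : {for z, continuous (fun z : R * R => z.1 ^+ 2 + z.2 ^+ 2)}.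
  by apply: continuousD; exact: continuousM.
apply: (@continuousB _ _ _ (fun z : R * R => L * (z.1 ^+ 2 + z.2 ^+ 2))
  (fun z : R * R => (z.1 ^+ 2 + z.2 ^+ 2) ^+ 2)); last exact: continuousM.
by apply: continuousM => //; exact: cst_continuous.
Qed.

Section Square.
Variables (rho eta : R).
Hypotheses (rho0 : 0 < rho) (rho_r : rho < r) (eta0 : 0 < eta).
Hypothesis S0 : forall x y, `|x| < eta -> `|y| < eta -> S x y = 0.

(* On the square the squared distance to the origin is at most [L / 2]. *)
Let L := 4 * rho ^+ 2.
Let w := weight L.
Let s x y := x ^+ 2 + y ^+ 2.

Let sq_le x : `|x| <= rho -> x ^+ 2 <= rho ^+ 2.
Proof. by move=> xr; rewrite -(real_normK (num_real x)) lerXn2r ?nnegrE// ltW. Qed.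

Let wE x y : w x y = s x y * (L - s x y).
Proof. by rewrite /w /weight /s; ring. Qed.

Let s_gt0 x y : S x y != 0 -> 0 < s x y.
Proof.
move=> Sn0; rewrite lt0r addr_ge0 ?sqr_ge0// andbT.
apply: contra_neq Sn0 => /eqP; rewrite paddr_eq0 ?sqr_ge0// !sqrf_eq0.
by move=> /andP[/eqP-> /eqP->]; apply: S0; rewrite normr0.
Qed.

Let w_gt0 x y : `|x| <= rho -> `|y| <= rho -> 0 < s x y -> 0 < w x y.
Proof.
move=> /sq_le xr /sq_le yr s0; rewrite wE mulr_gt0// /L.
have := exprn_gt0 2 rho0; move: xr yr; rewrite /s; lra.
Qed.

(* At the origin this is a division by zero, of value 0; as [S] vanishes nearby
   the ratio is continuous there too. *)
Let ratio n x y := S x y / w x y ^+ n.+2.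

Let ratio_cont n x y : `|x| <= rho -> `|y| <= rho ->
  {for (x, y), continuous (fun z : R * R => ratio n z.1 z.2)}.
Proof.
move=> xr yr; have [s0|s0] := ltP 0 (s x y).
  apply: (@continuousM _ _ (fun z => S z.1 z.2) (fun z => (w z.1 z.2 ^+ n.+2)^-1)).
    by apply: S_cont; exact: le_lt_trans rho_r.
  apply: continuousV => /=.
    by rewrite expf_neq0// gt_eqF// w_gt0.
  apply: (@continuous_comp _ _ _ (fun z : R * R => w z.1 z.2)
    (fun a : R => a ^+ n.+2)); first exact: weight_cont.
  exact: exprn_continuous.
have /eqP : s x y = 0 by apply/eqP; rewrite eq_le s0 addr_ge0 ?sqr_ge0.
rewrite paddr_eq0 ?sqr_ge0// !sqrf_eq0 => /andP[/eqP-> /eqP->].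
apply/cvgrPdist_le => e e0 /=.
exists (ball (0 : R) eta, ball (0 : R) eta) => /=.
  by split; exact: nbhsx_ballx.
move=> [a b] [/= ha hb]; rewrite /ratio !S0 ?normr0// ?mul0r ?subrr ?normr0 ?ltW//.
- by move: ha; rewrite /ball /= sub0r normrN.
- by move: hb; rewrite /ball /= sub0r normrN.
Qed.

(** By the maximum principle the ratio is largest on the boundary of the square. *)
Let ratio_max n x0 y0 : `|x0| <= rho -> `|y0| <= rho -> 0 < S x0 y0 ->
  exists x y, [/\ `|x| <= rho, `|y| <= rho, rho ^+ 2 <= s x y &
    S x0 y0 / w x0 y0 ^+ n.+2 <= S x y / w x y ^+ n.+2].
Proof.
move=> x0r y0r Sx0.
have [x [y [xr yr le_max]]] := square_max (ltW rho0) (@ratio_cont n).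
exists x, y; split=> //; last exact: le_max.
rewrite leNgt; apply/negP => s_small.
have sx0 : 0 < s x0 y0 by apply: s_gt0; rewrite gt_eqF.
have wx0 := w_gt0 x0r y0r sx0.
have C0 : 0 < ratio n x y.
  by apply: lt_le_trans (le_max _ _ x0r y0r); rewrite divr_gt0// exprn_gt0.
have Sxy : S x y != 0 by apply: contraTneq C0; rewrite /ratio => ->; rewrite mul0r ltxx.
have sxy := s_gt0 Sxy; have wxy := w_gt0 xr yr sxy.
have lt_rho (a b : R) : s a b < rho ^+ 2 -> `|a| < rho.
  move=> h; apply: (norm_lt_sqr (ltW rho0)).
  by apply: le_lt_trans h; rewrite lerDl sqr_ge0.
have xrho := lt_rho _ _ s_small.
have yrho : `|y| < rho by apply: (lt_rho y x); rewrite /s addrC.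
pose d := Num.min (rho - `|x|) (rho - `|y|).
have d0 : 0 < d by rewrite lt_min !subr_gt0 xrho.
have [dx dy] : d <= rho - `|x| /\ d <= rho - `|y|.
  by rewrite !ge_min !lexx orbT.
have dwy (b : R) : is_derive b 1 (fun t => w x t ^+ n.+2)
    (n.+2%:R * weight L b x ^+ n.+1 * weight_d L b x).
  have -> : (fun t => w x t ^+ n.+2) = (fun t => weight L t x ^+ n.+2).
    by apply/funext => c; rewrite /w weightC.
  exact: is_derive_weightX.
have xd : `|x| + d <= r by move: dx rho_r; lra.
have yd : `|y| + d <= r by move: dy rho_r; lra.
have L0 : 0 < L by rewrite /L mulr_gt0// exprn_gt0.
have touch : S x y = ratio n x y * w x y ^+ n.+2.
  by rewrite /ratio divfK// expf_neq0// gt_eqF.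
have below a b : `|a - x| < d -> `|b - y| < d -> S a b <= ratio n x y * w a b ^+ n.+2.
  move=> ax bx.
  have ar : `|a| <= rho.
    by have := ler_distD x a 0; rewrite !subr0; move: ax dx; lra.
  have br : `|b| <= rho.
    by have := ler_distD y b 0; rewrite !subr0; move: bx dy; lra.
  have [Sab|Sab] := eqVneq (S a b) 0.
    rewrite Sab mulr_ge0 ?(ltW C0)// exprn_ge0// wE.
    apply: mulr_ge0; first by rewrite addr_ge0 ?sqr_ge0.
    have := sq_le ar; have := sq_le br; have := exprn_gt0 2 rho0.
    by rewrite /L /s; lra.
  rewrite -ler_pdivrMr ?exprn_gt0// ?w_gt0// ?s_gt0//; exact: le_max.
exact: (no_touching_from_above hol dphi dpsi d0 xd yd C0 (exprn_gt0 n.+2 wxy)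
  (fun a _ => is_derive_weightX L n.+1 a y) (is_derive_weightX_d L n x y)
  (fun b _ => dwy b) (is_derive_weightX_d L n y x) touch below
  (weightX_superharmonic n L0 sxy wxy)).
Qed.

(** On the boundary [weight] is at least [3 * rho ^+ 4], and on the disc it is at
    most [rho ^+ 4], so that comparing the values of [S / weight ^+ n] on the
    disc with its maximum bounds [S] by a constant times [1 / 2 ^+ n], for every
    [n]. This is Hadamard's three circles argument with inner radius zero. *)
Lemma vanishing_square x y : x ^+ 2 + y ^+ 2 <= rho ^+ 2 / 4 ->
  phi x y = 0 /\ psi x y = 0.
Proof.
move=> sxy.
suff /eqP : S x y = 0.
  rewrite /S -!expr2 paddr_eq0 ?sqr_ge0// !sqrf_eq0.
  by move=> /andP[/eqP-> /eqP->].
have [-> //|Sn0] := eqVneq (S x y) 0; exfalso.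
have Spos : 0 < S x y by rewrite lt0r Sn0 S_ge0.
have rr := exprn_gt0 2 rho0.
have in_rho (a b : R) : s a b <= rho ^+ 2 / 4 -> `|a| <= rho.
  move=> h; apply: (norm_le_sqr (ltW rho0)).
  have := sqr_ge0 b; move: h; rewrite /s; lra.
have xr := in_rho _ _ sxy.
have yr : `|y| <= rho by apply: (in_rho y x); rewrite /s addrC.
have S_cont_rho a b : `|a| <= rho -> `|b| <= rho ->
    {for (a, b), continuous (fun z : R * R => S z.1 z.2)}.
  by move=> ar br; apply: S_cont; exact: le_lt_trans rho_r.
have [xM [yM [_ _ le_M]]] := square_max (ltW rho0) S_cont_rho.
pose M := S xM yM.
pose n := Num.truncn (M / S x y).
have [x1 [y1 [x1r y1r s1 le]]] := ratio_max n xr yr Spos.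
have w1 : 3 * rho ^+ 4 <= w x1 y1.
  have := sq_le x1r; have := sq_le y1r; rewrite wE /L => h1 h2.
  rewrite -subr_ge0.
  have -> : s x1 y1 * (4 * rho ^+ 2 - s x1 y1) - 3 * rho ^+ 4 =
     (s x1 y1 - rho ^+ 2) * (3 * rho ^+ 2 - s x1 y1) by ring.
  by rewrite mulr_ge0 ?subr_ge0//; move: h1 h2 rr; rewrite /s; lra.
have sxy0 := s_gt0 Sn0.
have wxy : w x y <= rho ^+ 4.
  have -> : w x y = 4 * rho ^+ 2 * s x y - s x y ^+ 2 by rewrite wE /L; ring.
  have -> : rho ^+ 4 = 4 * rho ^+ 2 * (rho ^+ 2 / 4) by field.
  apply: le_trans (_ : 4 * rho ^+ 2 * s x y <= _).
    by rewrite gerBl sqr_ge0.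
  by rewrite ler_pM2l// mulr_gt0.
have wpos := w_gt0 xr yr sxy0.
have w3 : 2 * w x y <= w x1 y1.
  apply: le_trans w1; have := exprn_gt0 4 rho0; move: wxy; lra.
have w1pos : 0 < w x1 y1 by apply: lt_le_trans w3; rewrite mulr_gt0.
move: le; rewrite ler_pdivrMr ?exprn_gt0//; apply/negP; rewrite -ltNge.
apply: le_lt_trans (_ : M / w x1 y1 ^+ n.+2 * w x y ^+ n.+2 < _).
  by rewrite ler_wpM2r ?exprn_ge0 ?(ltW wpos)// ler_wpM2r ?invr_ge0 ?exprn_ge0 ?le_M// ltW.
rewrite mulrAC ltr_pdivrMr ?exprn_gt0//.
apply: lt_le_trans (_ : S x y * (2 * w x y) ^+ n.+2 <= _); last first.
  apply: ler_wpM2l; first exact: ltW.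
  by apply: lerXn2r => //; rewrite nnegrE ltW// mulr_gt0.
rewrite exprMn [ltRHS]mulrA ltr_pM2r ?exprn_gt0// -ltr_pdivrMl// mulrC.
apply: lt_trans (truncnS_gt _) _; rewrite -natrX ltr_nat.
by apply: ltn_trans (ltn_expl n.+1 (ltnSn 1)) _; rewrite ltn_exp2l.
Qed.

End Square.
End Vanishing.

Lemma zero_gradient (R : realType) (F U V : R -> R -> R) (e : R) :
  0 < e -> F 0 0 = 0 ->
  (forall x y : R, `|x| < e -> `|y| < e ->
    is_derive x 1 (F^~ y) (U x y) /\ is_derive y 1 (F x) (V x y)) ->
  (forall x y : R, `|x| < e -> `|y| < e -> U x y = 0 /\ V x y = 0) ->
  forall x y : R, `|x| < e -> `|y| < e -> F x y = 0.
Proof.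
move=> e0 F0 dF UV0 x y xe ye; rewrite -F0.
have z0 : `|0 : R| < e by rewrite normr0.
have -> : F x y = F 0 y.
  apply: (@derive0_cst R e (F^~ y)) => // s se.
  by have [+ _] := dF s y se ye; rewrite (UV0 s y se ye).1.
apply: (@derive0_cst R e (F 0)) => // t te.
by have [_] := dF 0 t z0 te; rewrite (UV0 0 t z0 te).2.
Qed.

(** The primitive [phi + i psi] of [u + i v] that vanishes at the origin vanishes
    near it, hence on a disc, and so does its derivative [u + i v]. *)
Lemma identity_at_origin (R : realType) (u v : R -> R -> R) (r eta : R) :
  0 < r -> 0 < eta ->
  (forall x y : R, `|x| <= r -> `|y| <= r ->
    exists p q : R, has_diff u x y p (- q) /\ has_diff v x y q p) ->
  (forall x y : R, `|x| < eta -> `|y| < eta -> u x y = 0 /\ v x y = 0) ->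
  forall x y : R, x ^+ 2 + y ^+ 2 < r ^+ 2 / 16 -> u x y = 0 /\ v x y = 0.
Proof.
move=> r0 eta0 hol uv0.
have [|phi [phi00 dphi]] := @closed_form_exact R u (fun x y => - v x y) r r0.
  move=> x y xr yr; have [p [q [du dv]]] := hol x y xr yr.
  by exists p, (- q), (- p); split=> //; exact: has_diffN.
have [|psi [psi00 dpsi]] := @closed_form_exact R v u r r0.
  by move=> x y xr yr; have [p [q [du dv]]] := hol x y xr yr; exists q, p, (- q).
have hol' (x y : R) : `|x| < r -> `|y| < r ->
    exists p q : R, has_diff u x y p (- q) /\ has_diff v x y q p.
  by move=> xr yr; apply: hol; exact: ltW.
pose e := Num.min eta r.
have e0 : 0 < e by rewrite lt_min eta0.
have ee (x : R) : `|x| < e -> `|x| < eta /\ `|x| < r.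
  by rewrite lt_min => /andP[].
have phi0 (x y : R) : `|x| < e -> `|y| < e -> phi x y = 0.
  apply: (@zero_gradient R phi u (fun x y => - v x y) e) => // s t se te.
    by apply: dphi; [case: (ee _ se) | case: (ee _ te)].
  by have [] := uv0 s t (ee _ se).1 (ee _ te).1 => -> ->; rewrite oppr0.
have psi0 (x y : R) : `|x| < e -> `|y| < e -> psi x y = 0.
  apply: (@zero_gradient R psi v u e) => // s t se te.
    by apply: dpsi; [case: (ee _ se) | case: (ee _ te)].
  by have [] := uv0 s t (ee _ se).1 (ee _ te).1.
have r20 : 0 < r / 2 by rewrite divr_gt0.
have r2r : r / 2 < r by rewrite ltr_pdivrMr// ltr_pMr// ltr1n.
have zero (x y : R) : x ^+ 2 + y ^+ 2 < r ^+ 2 / 16 -> phi x y = 0 /\ psi x y = 0.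
  move=> h; apply: (vanishing_square hol' dphi dpsi r20 r2r e0).
    by move=> s t se te; rewrite phi0// psi0// mulr0 addr0.
  by apply: (le_trans (ltW h)); rewrite le_eqVlt; apply/orP; left; apply/eqP; field.
move=> x y h.
have in_r (a b : R) : a ^+ 2 + b ^+ 2 < r ^+ 2 / 16 -> `|a| < r.
  move=> h'; apply: (norm_lt_sqr (ltW r0)).
  by have := sqr_ge0 b; have := exprn_gt0 2 r0; lra.
have xr := in_r _ _ h; have yr : `|y| < r by apply: (in_r y x); rewrite addrC.
have zero_near : \near x, x ^+ 2 + y ^+ 2 < r ^+ 2 / 16.
  have c : {for x, continuous (fun s : R => s ^+ 2 + y ^+ 2)}.
    apply: (@continuousD _ _ _ (fun s : R => s ^+ 2) (fun=> y ^+ 2)).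
      exact: exprn_continuous.
    exact: cst_continuous.
  exact: (c _ (lt_nbhsl h)).
have der0 (F : R -> R -> R) (l : R) : is_derive x 1 (F^~ y) l ->
    (forall x y : R, x ^+ 2 + y ^+ 2 < r ^+ 2 / 16 -> F x y = 0) -> l = 0.
  move=> dF F0.
  have : is_derive x 1 (F^~ y) 0.
    apply: (@near_eq_is_derive _ _ _ (cst 0)).
    by near=> s; rewrite /cst F0//; near: s.
  by case=> _; case: dF => _ -> .
split.
  by apply: (der0 phi _ (dphi x y xr yr).1) => s t /zero[].
by apply: (der0 psi _ (dpsi x y xr yr).1) => s t /zero[].
Unshelve. all: by end_near.
Qed.

(** * Complex derivatives *)

Section ComplexToReal.
Variable R : realType.
Local Open Scope complex_scope.
Local Notation Re := (@complex.Re R).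
Local Notation Im := (@complex.Im R).
Implicit Types (W : R[i] -> R[i]) (z : R[i]).

Lemma Re_Im_le_normc z (c : R) : `|z| <= c%:C -> `|Re z| <= c /\ `|Im z| <= c.
Proof.
rewrite normc_def lecR => zc; split; apply: le_trans zc.
  by rewrite -sqrtr_sqr ler_wsqrtr// lerDl sqr_ge0.
by rewrite -sqrtr_sqr ler_wsqrtr// lerDr sqr_ge0.
Qed.

Lemma normc_le_Re_Im z : `|z| <= (`|Re z| + `|Im z|)%:C.
Proof.
rewrite normc_def lecR -[leRHS]ger0_norm ?addr_ge0// -sqrtr_sqr ler_wsqrtr//.
rewrite sqrrD !real_normK ?num_real// lerD2r lerDl.
by rewrite mulrn_wge0// mulr_ge0.
Qed.

(** The Cauchy-Riemann equations, with [p + i q] the complex derivative. *)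
Lemma derivable_has_diff W (x y : R) :
  derivable (W : R[i]^o -> R[i]^o) (x +i* y) 1 -> exists p q : R,
    has_diff (fun s t => Re (W (s +i* t))) x y p (- q) /\
    has_diff (fun s t => Im (W (s +i* t))) x y q p.
Proof.
move=> /cvg_ex [[p q] /cvgrPdist_le /= dW].
suff main e : 0 < e -> exists d, 0 < d /\ forall s t : R,
    `|s - x| < d -> `|t - y| < d ->
    `|W (s +i* t) - W (x +i* y) - (p +i* q) * ((s - x) +i* (t - y))|
      <= (e * (`|s - x| + `|t - y|))%:C.
  exists p, q; split=> e /main [d [d0 hd]]; exists d; split=> // s t sd td.
    have [+ _] := Re_Im_le_normc (hd s t sd td).
    case: (W (s +i* t)) (W (x +i* y)) => a b [a' b'] /=.
    by congr (`|_| <= _); ring.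
  have [_] := Re_Im_le_normc (hd s t sd td).
  case: (W (s +i* t)) (W (x +i* y)) => a b [a' b'] /=.
  by congr (`|_| <= _); ring.
move=> e0; have e0' : (0 : R[i]) < e%:C by rewrite ltcR.
have [d /= d0 hd] := dW _ e0'.
have dE : d = (Re d)%:C by rewrite RRe_real// gtr0_real.
have rd0 : 0 < Re d by move: d0; rewrite dE ltcR.
exists (Re d / 2); split; first by rewrite divr_gt0.
move=> s t sd td.
pose h := (s - x) +i* (t - y).
have hE : `|h| <= (`|s - x| + `|t - y|)%:C by exact: normc_le_Re_Im.
have [h0|hn0] := eqVneq h 0.
  move: h0 => /eqP; rewrite eq_complex /= !subr_eq0 => /andP[/eqP-> /eqP->].
  by rewrite !subrr !normr0 addr0 mulr0 sub0r mulr0 oppr0 normr0.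
have hd' : `|0 - h| < d.
  rewrite sub0r normrN dE; apply: le_lt_trans hE _; rewrite ltcR.
  by move: sd td; lra.
have := hd h hd' hn0; rewrite /shift /=.
have -> : (h *: 1 + (x +i* y) : R[i]) = s +i* t.
  by rewrite /GRing.scale /= mulr1 /h; apply/eqP; rewrite eq_complex /= !subrK !eqxx.
set dd := W _ - W _ => le.
have -> : dd - (p +i* q) * h = - (((p +i* q) - h^-1 *: dd) * h).
  rewrite /GRing.scale /= mulrBl mulrAC mulVf// mul1r opprB //.
rewrite normrN normrM; apply: le_trans (_ : e%:C * `|h| <= _).
  by rewrite ler_wpM2r.
by rewrite rmorphM/= ler_wpM2l// ltW.
Qed.

Lemma has_diff_translate (P : R -> R -> R) (a b x y px py : R) :
  has_diff P (a + x) (b + y) px py ->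
  has_diff (fun s t => P (a + s) (b + t)) x y px py.
Proof.
move=> dP e /dP [d [d0 hd]]; exists d; split=> // s t sd td.
have e1 (c p q : R) : c + p - (c + q) = p - q by ring.
by have := hd (a + s) (b + t); rewrite !e1; apply.
Qed.

Lemma identity_near W (a b r eta : R) : 0 < r -> 0 < eta ->
  (forall x y : R, `|x - a| <= r -> `|y - b| <= r ->
     derivable (W : R[i]^o -> R[i]^o) (x +i* y) 1) ->
  (forall x y : R, `|x - a| < eta -> `|y - b| < eta -> W (x +i* y) = 0) ->
  forall x y : R, (x - a) ^+ 2 + (y - b) ^+ 2 < r ^+ 2 / 16 -> W (x +i* y) = 0.
Proof.
move=> r0 eta0 dW W0 x y h.
have tr (c d : R) : c + d - c = d by ring.
have [||re im] := @identity_at_origin R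
    (fun s t => Re (W ((a + s) +i* (b + t))))
    (fun s t => Im (W ((a + s) +i* (b + t)))) r eta r0 eta0 _ _ _ _ h.
- move=> s t sr tr'; have [|p [q [d1 d2]]] := @derivable_has_diff W (a + s) (b + t).
    by apply: dW; rewrite tr.
  exists p, q; split.
    exact: (has_diff_translate (P := fun s t => Re (W (s +i* t)))).
  exact: (has_diff_translate (P := fun s t => Im (W (s +i* t)))).
- by move=> s t se te; rewrite W0 ?tr.
move: re im; rewrite !subrKC.
by case: (W _) => ? ? /= -> ->.
Qed.

End ComplexToReal.

(** * The identity theorem on circular domains *)

Section Circular.
Variable R : realType.
Local Open Scope complex_scope.
Implicit Types (D Z : set R[i]) (q : quat R) (x y s t : R).

(** Openness in terms of the real and imaginary parts, the form in which it is
    used throughout. *)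
Definition plane_open Z := forall x y, Z (x +i* y) -> exists d, 0 < d /\
  forall s t, `|s - x| < d -> `|t - y| < d -> Z (s +i* t).

(** Every quaternion is [x + y I] for an imaginary unit [I] and [y >= 0]; this is
    [x + i y], which depends continuously on the quaternion. *)
Definition half_plane q : R[i] :=
  q 0 0 +i* Num.sqrt (q 0 1 ^+ 2 + q 0 2 ^+ 2 + q 0 3 ^+ 2).

Lemma half_plane_slice_point x y I : imag_units I ->
  half_plane (slice_point (x +i* y) I) = x +i* `|y|.
Proof.
move=> /imag_unitsP[I0 I1]; rewrite /half_plane /slice_point /=.
rewrite !(quatD, quatZ) /GRing.one /= /qone !mkqE I0.
rewrite !mulr0 !add0r mulr1 addr0 !exprMn -!mulrDr I1 mulr1 sqrtr_sqr //.
Qed.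

(** For [D] invariant under conjugation, [circularization D] is a preimage under
    a continuous map: this is what carries open sets of the plane to open sets of
    quaternions. *)
Lemma circularizationE D q : conj_invariant D ->
  circularization D q <-> D (half_plane q).
Proof.
move=> cD; split=> [[[x y] [I [Dz SI ->]]]|Dq].
  rewrite half_plane_slice_point//; have [y0|y0] := leP 0 y.
    by rewrite ger0_norm.
  by have := cD _ Dz; rewrite ltr0_norm.
pose n := Num.sqrt (q 0 1 ^+ 2 + q 0 2 ^+ 2 + q 0 3 ^+ 2).
have nn : n ^+ 2 = q 0 1 ^+ 2 + q 0 2 ^+ 2 + q 0 3 ^+ 2.
  by rewrite sqr_sqrtr// !addr_ge0 ?sqr_ge0.
have [n0|n0] := eqVneq n 0.
  exists (half_plane q), (qi R); split=> //; first exact: qi_imag_unit.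
  move: nn; rewrite n0 expr0n /= => /esym/eqP.
  rewrite !paddr_eq0 ?addr_ge0 ?sqr_ge0// !sqrf_eq0.
  move=> /andP[/andP[/eqP q1 /eqP q2] /eqP q3].
  apply/quatP; rewrite /slice_point /= -/n n0 !(quatD, quatZ).
  rewrite /GRing.one /= /qone !mkqE q1 q2 q3.
  by split; ring.
exists (half_plane q), (mkq 0 (q 0 1 / n) (q 0 2 / n) (q 0 3 / n)); split=> //.
  apply/imag_unitsP; rewrite !mkqE; split=> //.
  by rewrite !exprMn -!mulrDl -nn exprVn mulfV// expf_neq0.
apply/quatP; rewrite /slice_point /= -/n !(quatD, quatZ).
rewrite /GRing.one /= /qone !mkqE.
by split; field.
Qed.

Lemma half_plane_continuous q (d : R) : 0 < d -> \forall q' \near q,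
  `|complex.Re (half_plane q') - complex.Re (half_plane q)| < d /\
  `|complex.Im (half_plane q') - complex.Im (half_plane q)| < d.
Proof.
move=> d0.
have cc k : {for q, continuous (fun p : quat R => p 0 k : R)}.
  exact: coord_continuous.
have c2 k : {for q, continuous (fun p : quat R => (p 0 k : R) ^+ 2)}.
  by apply: (@continuous_comp _ _ _ (fun p : quat R => p 0 k : R) (fun a : R => a ^+ 2));
    [exact: cc | exact: exprn_continuous].
have cs : {for q, continuous (fun p : quat R =>
    Num.sqrt ((p 0 1 : R) ^+ 2 + p 0 2 ^+ 2 + p 0 3 ^+ 2))}.
  apply: (@continuous_comp _ _ _ (fun p : quat R => (p 0 1 : R) ^+ 2 + p 0 2 ^+ 2 + p 0 3 ^+ 2)
    (fun a : R => Num.sqrt a)); last exact: sqrt_continuous.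
  apply: (@continuousD _ _ _ (fun p : quat R => (p 0 1 : R) ^+ 2 + p 0 2 ^+ 2)
    (fun p : quat R => (p 0 3 : R) ^+ 2)) => //.
  exact: (@continuousD _ _ _ (fun p : quat R => (p 0 1 : R) ^+ 2)
    (fun p : quat R => (p 0 2 : R) ^+ 2)).
have n1 := cvgr_dist_lt _ _ (cc 0) _ d0.
have n2 := cvgr_dist_lt _ _ cs _ d0.
near=> q'; split; rewrite distrC; near: q'; [exact: n1|exact: n2].
Unshelve. all: by end_near.
Qed.

Lemma plane_open_preimage Z : plane_open Z -> open [set q | Z (half_plane q)].
Proof.
move=> oZ; rewrite openE => q /= Zq; have [d [d0 hd]] := oZ _ _ Zq.
rewrite /interior; near=> q'.
have [h1 h2] : `|complex.Re (half_plane q') - complex.Re (half_plane q)| < d /\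
  `|complex.Im (half_plane q') - complex.Im (half_plane q)| < d.
  by near: q'; exact: half_plane_continuous.
exact: hd h1 h2.
Unshelve. all: by end_near.
Qed.

Lemma circularization_plane_open D : conj_invariant D ->
  open (circularization D) -> plane_open D.
Proof.
move=> cD oD x y Dz.
pose f (z : R * R) : quat R := z.1 *: 1 + z.2 *: qi R.
have fE s t : f (s, t) = slice_point (s +i* t) (qi R) by [].
have cf : {for (x, y), continuous f}.
  apply: (@continuousD _ _ _ (fun z : R * R => z.1 *: (1 : quat R))
     (fun z : R * R => z.2 *: qi R)).
    by apply: (@cvgZr_tmp _ _ _ _ _ (fst : R * R -> R)); exact: cvg_fst.
  by apply: (@cvgZr_tmp _ _ _ _ _ (snd : R * R -> R)); exact: cvg_snd.
have Of : circularization D (f (x, y)).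
  by exists (x +i* y), (qi R); split=> //; exact: qi_imag_unit.
have : nbhs (x, y) (f @^-1` circularization D) by apply: cf; exact: open_nbhs_nbhs.
move=> /nbhs_ballP [d /= d0 hd]; exists d; split=> // s t sx ty.
have /hd : ball (x, y) d (s, t) by split; rewrite /ball /= distrC.
rewrite /preimage /= fE => /(circularizationE _ cD).
rewrite half_plane_slice_point; last exact: qi_imag_unit.
have [t0|t0] := leP 0 t; first by rewrite ger0_norm.
by rewrite ltr0_norm// => /cD; rewrite /= opprK.
Qed.

(** The set [D] need not be connected: it may consist of two pieces exchanged by
    conjugation. The usual argument is therefore run on [circularization D]: the
    interior [Z] of the zero set of [W] is invariant under conjugation and both
    open and closed in [D], so that its circularization is open and closed in a
    connected set. *)
Lemma identity_on_circular D (W : R[i] -> R[i]) :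
  conj_invariant D -> open (circularization D) -> connected (circularization D) ->
  (forall z, D z -> derivable (W : R[i]^o -> R[i]^o) z 1) ->
  (forall z, D z -> W z = 0 -> W (z^* ) = 0) ->
  (exists2 Z, plane_open Z & (Z !=set0) /\ forall z, Z z -> D z /\ W z = 0) ->
  forall z, D z -> W z = 0.
Proof.
move=> cD oO conO dW W_conj [Z0 oZ0 [[z0 Zz0] Z0W]].
have oD := circularization_plane_open cD oO.
pose Z : set R[i] := [set z | exists2 d, 0 < d & forall s t,
  `|s - complex.Re z| < d -> `|t - complex.Im z| < d ->
  D (s +i* t) /\ W (s +i* t) = 0].
have Z_self z : Z z -> D z /\ W z = 0.
  by case: z => x y [d d0]; apply; rewrite subrr normr0.
have cZ : conj_invariant Z.
  move=> [x y] [d d0 hd]; exists d => // s t sx ty.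
  have ty' : `|- t - y| < d by rewrite -normrN opprD !opprK -[X in _ + X]opprK.
  have [D1 W1] := hd s (- t) sx ty'.
  have := cD _ D1; have := W_conj _ D1 W1; rewrite /= opprK //.
have oZ : plane_open Z.
  move=> x y [d d0 hd]; exists (d / 2); split; first by rewrite divr_gt0.
  move=> s t sx ty; exists (d / 2); first by rewrite divr_gt0.
  move=> s' t' /= sx' ty'; apply: hd => /=.
    by have := ler_distD s s' x; lra.
  by have := ler_distD t t' y; lra.
(* A point of [Z] within [r / 32] of [(x, y)] is the centre of a square of
   half-side [r / 2] in [D]; the disc of radius [r / 8] about it, on which [W]
   then vanishes, contains a neighbourhood of [(x, y)]. *)
have oY : plane_open (D `\` Z).
  move=> x y [Dz nZ]; have [r [r0 hr]] := oD x y Dz.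
  exists (r / 32); split; first by rewrite divr_gt0.
  move=> s t sx ty; split; first by apply: hr; lra.
  move=> [d d0 hd]; apply: nZ; exists (r / 32); first by rewrite divr_gt0.
  move=> s' t' /= sx' ty'; split; first by apply: hr; lra.
  apply: (@identity_near R W s t (r / 2) d) => //.
  - by rewrite divr_gt0.
  - move=> a b ha hb; apply/dW/hr.
      by have := ler_distD s a x; lra.
    by have := ler_distD t b y; lra.
  - by move=> a b ha hb; have [] := hd a b ha hb.
  have sq (a b c : R) : `|a - c| < r / 32 -> `|b - c| < r / 32 ->
      (a - b) ^+ 2 <= (r / 16) ^+ 2.
    move=> h1 h2; rewrite -[(a - b) ^+ 2]real_normK ?num_real//.
    apply: lerXn2r; rewrite ?nnegrE//; first by rewrite divr_ge0// ltW.
    by have := ler_distD c a b; rewrite (distrC c b); lra.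
  have h1 := sq _ _ _ sx' sx; have h2 := sq _ _ _ ty' ty.
  have := exprn_gt0 2 r0; move: h1 h2; rewrite !exprMn !exprVn -!natrX.
  lra.
have B_eq : circularization D `&` [set q | Z (half_plane q)] = circularization D.
  apply: conO.
  - exists (slice_point z0 (qi R)); split.
      by exists z0, (qi R); split; [case: (Z0W _ Zz0) | exact: qi_imag_unit | ].
    have Zz : Z z0.
      case: z0 Zz0 => x y Zz0; have [d [d0 hd]] := oZ0 x y Zz0.
      by exists d => // s t sx ty; apply: Z0W; exact: hd.
    have : circularization Z (slice_point z0 (qi R)).
      by exists z0, (qi R); split=> //; exact: qi_imag_unit.
    by move=> /(circularizationE _ cZ).
  - by exists [set q | Z (half_plane q)] => //; exact: plane_open_preimage.
  - exists (~` [set q | (D `\` Z) (half_plane q)]).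
      by apply: open_closedC; exact: plane_open_preimage.
    apply/seteqP; split=> q [Oq] /=; first by move=> Zq; split=> // -[].
    move=> nY; split=> //; apply: contrapT => nZ; apply: nY; split=> //.
    exact/(circularizationE _ cD).
move=> z Dz.
have Oz : circularization D (slice_point z (qi R)).
  by exists z, (qi R); split=> //; exact: qi_imag_unit.
rewrite -B_eq in Oz; case: Oz => _ /=.
case: z Dz => x y Dz; rewrite half_plane_slice_point; last exact: qi_imag_unit.
have [y0|y0] := leP 0 y; first by rewrite ger0_norm// => /Z_self[].
by rewrite ltr0_norm// => /cZ/Z_self[_]; rewrite /= opprK.
Qed.

End Circular.

(** * Slice functions in complex coordinates *)

Section Coordinates.
Variable R : realType.
Local Open Scope complex_scope.
Local Notation Re := (@complex.Re R).
Local Notation Im := (@complex.Im R).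
Implicit Types (p q I X Y : quat R) (z : R[i]) (D : set R[i]).
Implicit Types (U V : quatC R) (F G : R[i] -> quatC R) (a b : R[i] -> R[i]).

Local Notation holomorphic_at a z := (derivable (a : R[i]^o -> R[i]^o) z 1).

Definition vec p : quat R := mkq 0 (p 0 1) (p 0 2) (p 0 3).

Lemma ord4P (k : 'I_4) : k != 0 -> [\/ k = 1, k = 2 | k = 3].
Proof.
case: k => -[|[|[|[|//]]]] lt4 // _.
- by constructor 1; apply: val_inj.
- by constructor 2; apply: val_inj.
- by constructor 3; apply: val_inj.
Qed.

Lemma coordC_conj D F z k : stem_function D F -> D z ->
  coordC (F (z^* )) 0 k = (coordC (F z) 0 k)^*.
Proof. by move=> [_ sF] Dz; rewrite sF// !mxE. Qed.

(** The commutator in the complexified quaternions is twice the cross product of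
    the vector parts, which are in the complex space of dimension 3. *)
Lemma mulC_comm U V : Defs.mulC U V = Defs.mulC V U <->
  forall i j : 'I_4, i != 0 -> j != 0 ->
    coordC U 0 i * coordC V 0 j = coordC U 0 j * coordC V 0 i.
Proof.
have coE W k : coordC W 0 k = W.1 0 k +i* W.2 0 k by rewrite mxE.
split=> [e|e].
  have e12 : coordC U 0 1 * coordC V 0 2 = coordC U 0 2 * coordC V 0 1.
    move: e => [/quatP[_ _ _ +] /quatP[_ _ _ +]].
    rewrite !(quatD, quatN) /GRing.mul /= /qmul !mkqE => e1 e2.
    by rewrite !coE; apply/eqP; rewrite eq_complex /=; apply/andP; split; apply/eqP; lra.
  have e23 : coordC U 0 2 * coordC V 0 3 = coordC U 0 3 * coordC V 0 2.
    move: e => [/quatP[_ + _ _] /quatP[_ + _ _]].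
    rewrite !(quatD, quatN) /GRing.mul /= /qmul !mkqE => e1 e2.
    by rewrite !coE; apply/eqP; rewrite eq_complex /=; apply/andP; split; apply/eqP; lra.
  have e31 : coordC U 0 3 * coordC V 0 1 = coordC U 0 1 * coordC V 0 3.
    move: e => [/quatP[_ _ + _] /quatP[_ _ + _]].
    rewrite !(quatD, quatN) /GRing.mul /= /qmul !mkqE => e1 e2.
    by rewrite !coE; apply/eqP; rewrite eq_complex /=; apply/andP; split; apply/eqP; lra.
  by move=> i j /ord4P[]-> /ord4P[]->; rewrite ?e12 ?e23 ?e31.
have := e 1 2 isT isT; have := e 2 3 isT isT; have := e 3 1 isT isT.
rewrite !coE => /eqP + /eqP + /eqP; rewrite !eq_complex /=.
move=> /andP[/eqP r31 /eqP i31] /andP[/eqP r23 /eqP i23] /andP[/eqP r12 /eqP i12].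
rewrite /Defs.mulC; congr pair; apply/quatP.
  by rewrite !(quatD, quatN) /GRing.mul /= /qmul !mkqE; split; lra.
by rewrite !(quatD, quatN) /GRing.mul /= /qmul !mkqE; split; lra.
Qed.

Lemma slice_value0 X Y : (forall I, imag_units I -> X + I * Y = 0) <-> (X, Y) = (0, 0).
Proof.
split=> [h|[-> ->] I _]; last by rewrite mulr0 addr0.
have i1 := h _ (qi_imag_unit R); have i2 := h _ (imag_unitsN (qi_imag_unit R)).
have X0 : X = 0.
  have : 2 *: X = 0.
    have -> : 2 *: X = (X + qi R * Y) + (X + - qi R * Y).
      by rewrite mulNr addrACA subrr addr0 scaler_nat mulr2n.
    by rewrite i1 i2 addr0.
  by move=> /eqP; rewrite scaler_eq0 pnatr_eq0 /= => /eqP.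
move: i1; rewrite X0 add0r => /(congr1 ( *%R (qi R))).
by rewrite mulrA qi_imag_unit mulN1r mulr0 => /eqP; rewrite oppr_eq0 => /eqP->.
Qed.

Lemma slice_wedge_vanishes Omega f g D F G :
  induced_by Omega f D F -> induced_by Omega g D G ->
  vanishes_on Omega (slice_wedge Omega f g) <->
  forall z, D z -> Defs.mulC (F z) (G z) = Defs.mulC (G z) (F z).
Proof.
move=> fF gG; have [_ eO _] := fF.
have wE z I : D z -> imag_units I -> slice_wedge Omega f g (slice_point z I) =
    2^-1 *: ((Defs.mulC (F z) (G z)).1 - (Defs.mulC (G z) (F z)).1) +
    I * (2^-1 *: ((Defs.mulC (F z) (G z)).2 - (Defs.mulC (G z) (F z)).2)).
  move=> Dz SI; rewrite /slice_wedge (slice_mulE fF gG)// (slice_mulE gG fF)//.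
  by rewrite -scalerAr -scalerDr mulrBr opprD addrACA.
split=> [v z Dz|e q].
  have : forall I, imag_units I ->
      2^-1 *: ((Defs.mulC (F z) (G z)).1 - (Defs.mulC (G z) (F z)).1) +
      I * (2^-1 *: ((Defs.mulC (F z) (G z)).2 - (Defs.mulC (G z) (F z)).2)) = 0.
    by move=> I SI; rewrite -wE//; apply: v; rewrite eO; exists z, I.
  move: (Defs.mulC (F z) (G z)) (Defs.mulC (G z) (F z)) => [X Y] [X' Y'] /=.
  move=> /slice_value0 [] /eqP + /eqP; rewrite !scaler_eq0 invr_eq0 pnatr_eq0 /= !subr_eq0.
  by move=> /eqP-> /eqP->.
rewrite {1}eO => -[z [I [Dz SI ->]]].
by rewrite wE// e// !subrr !scaler0 mulr0 addr0.
Qed.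

(** The embedding of the complex numbers as the stem values of slice-preserving
    functions. *)
Definition scalarC z : quatC R := ((Re z)%:A, (Im z)%:A).

Lemma scalarC_slice_mul z X Y I : imag_units I ->
  ((scalarC z).1 + I * (scalarC z).2) * (X + I * Y) =
  (Re z *: X - Im z *: Y) + I * (Re z *: Y + Im z *: X).
Proof.
move=> SI; rewrite /scalarC /= mulr_algr mulrDl mulr_algl -scalerAl.
rewrite [I * (X + _)]mulrDr mulrA SI mulN1r mulrDr -!scalerAr !scalerDr scalerN.
by rewrite [_ *: (I * X) + _]addrC addrACA.
Qed.

Lemma slice_vecE Omega f D F z I : induced_by Omega f D F -> D z -> imag_units I ->
  slice_vec Omega f (slice_point z I) = vec (F z).1 + I * vec (F z).2.
Proof.
move=> fF Dz SI; rewrite /slice_vec (slice_conjE fF)//.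
have [sF eO fE] := fF; rewrite fE; last by rewrite eO; exists z, I.
rewrite (slice_funE sF)// opprD addrACA -mulrBr scalerDr scalerAr.
have vE p : 2^-1 *: (p - qconj p) = vec p.
  by apply/quatP; rewrite !(quatZ, quatD, quatN) !mkqE; split; field.
by rewrite !vE.
Qed.

Lemma holomorphic_coord D F k z : holomorphic_on D F -> D z ->
  holomorphic_at (fun w => coordC (F w) 0 k) z.
Proof.
move=> hF /hF /cvg_ex [l hl]; apply/cvg_ex; exists (l 0 k).
have := cvg_comp _ _ hl (@coord_continuous R[i] 1 4 0 k l).
by apply: cvg_trans; apply: near_eq_cvg; near=> h; rewrite /= !mxE.
Unshelve. all: by end_near.
Qed.

Lemma holomorphic_scalarC D a : (forall z, D z -> holomorphic_at a z) ->
  holomorphic_on D (scalarC \o a).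
Proof.
move=> ha z Dz; have /cvg_ex [l hl] := ha z Dz.
have sE w : coordC (scalarC w) = w *: delta_mx 0 0.
  apply/rowP => k; rewrite [LHS]mxE [RHS]mxE [delta_mx _ _ _ _]mxE /= !quatZ.
  rewrite /GRing.one /= /qone.
  case: w => x y /=; have [->|/ord4P[]->] := eqVneq k 0; rewrite !mkqE /=.
  - by rewrite !mulr1.
  - by rewrite !mulr0.
  - by rewrite !mulr0.
  - by rewrite !mulr0.
apply/cvg_ex; exists (l *: (delta_mx 0 0 : 'rV[R[i]]_4)).
rewrite [X in X @ _](_ : _ = *:%R^~ (delta_mx 0 0 : 'rV[R[i]]_4) \o
    (fun h : R[i] => h^-1 *: ((a \o shift z) (h *: (1 : R[i]^o)) - a z : R[i]^o))).
  exact: (cvg_comp _ _ hl (@scalel_continuous _ _ _ _)).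
by apply/funext => h; rewrite /= !sE -scalerBl scalerA.
Qed.

End Coordinates.

Arguments scalarC {R} z.

(** * Linear dependence over the slice-preserving functions *)

Section Dependence.
Variable R : realType.
Local Open Scope complex_scope.
Local Notation Re := (@complex.Re R).
Local Notation Im := (@complex.Im R).
Implicit Types (z : R[i]) (D : set R[i]) (F G : R[i] -> quatC R).
Implicit Types (a b : R[i] -> R[i]) (Omega : set (quat R)).

(** Through [scalarC], these are the stem functions of the slice-preserving
    regular functions. *)
Definition real_holomorphic D a :=
  (forall z, D z -> derivable (a : R[i]^o -> R[i]^o) z 1) /\
  (forall z, D z -> a (z^* ) = (a z)^*).

Lemma real_holomorphic_coord D F k : stem_function D F -> holomorphic_on D F ->
  real_holomorphic D (fun z => coordC (F z) 0 k).
Proof.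
move=> sF hF; split=> z Dz; first exact: holomorphic_coord hF Dz.
exact: coordC_conj sF Dz.
Qed.

Lemma real_holomorphicN D a :
  real_holomorphic D a -> real_holomorphic D (fun z => - a z).
Proof.
move=> [da ca]; split=> z Dz; first exact: (derivableN (da z Dz)).
by rewrite ca// rmorphN.
Qed.

Lemma real_holomorphic_cst D (c : R) : real_holomorphic D (fun=> c%:C).
Proof.
split=> z _; first exact: derivable_cst.
by rewrite /= oppr0.
Qed.

Lemma nonzero_plane_open D a : plane_open D ->
  (forall z, D z -> derivable (a : R[i]^o -> R[i]^o) z 1) ->
  plane_open [set z | D z /\ a z != 0].
Proof.
move=> oD da x y [Dz az].
have [d [d0 hd]] := oD x y Dz.
have [p [q [dre dim]]] := derivable_has_diff (da _ Dz).
have nz (P : R -> R -> R) px py : has_diff P x y px py -> P x y != 0 ->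
    exists d', 0 < d' /\ forall s t, `|s - x| < d' -> `|t - y| < d' -> P s t != 0.
  move=> dP P0; have e0 : 0 < `|P x y| / 2 by rewrite divr_gt0// normr_gt0.
  have [d' [d'0 hd']] := has_diff_cont dP e0; exists d'; split=> // s t sx ty.
  apply: contraTneq (hd' s t sx ty) => ->.
  by rewrite sub0r normrN -ltNge ltr_pdivrMr// ltr_pMr ?normr_gt0// ltr1n.
have [d' [d'0 hd']] : exists d', 0 < d' /\ forall s t,
    `|s - x| < d' -> `|t - y| < d' -> a (s +i* t) != 0.
  move: az; rewrite eq_complex /= negb_and => /orP[r0|i0].
    have [d' [d'0 hd']] := nz _ _ _ dre r0; exists d'; split=> // s t sx ty.
    by rewrite eq_complex /= negb_and (hd' s t sx ty).
  have [d' [d'0 hd']] := nz _ _ _ dim i0; exists d'; split=> // s t sx ty.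
  by rewrite eq_complex /= negb_and (hd' s t sx ty) orbT.
exists (Num.min d d'); split; first by rewrite lt_min d0.
move=> s t; rewrite !lt_min => /andP[? ?] /andP[? ?].
by split; [exact: hd | exact: hd'].
Qed.

(** If the minors vanish and some coordinate [F_k] is not identically zero, then
    [a = G_k] and [b = - F_k] give a dependence relation; if there is none,
    [a = 1] and [b = 0] do. Conversely a relation [a F + b G = 0] makes the
    product of each minor with [a], and with [b], vanish. The minors are thus
    zero on the nonempty open set where [a], or [b], is nonzero, hence everywhere
    by the identity theorem. *)
Lemma minors_vanish_iff_dependent D F G : conj_invariant D ->
  open (circularization D) -> connected (circularization D) -> D !=set0 ->
  stem_function D F -> holomorphic_on D F ->
  stem_function D G -> holomorphic_on D G ->
  (forall z, D z -> forall i j : 'I_4, i != 0 -> j != 0 ->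
    coordC (F z) 0 i * coordC (G z) 0 j = coordC (F z) 0 j * coordC (G z) 0 i) <->
  exists a b, [/\ real_holomorphic D a, real_holomorphic D b,
    forall z, D z -> forall k : 'I_4, k != 0 ->
      a z * coordC (F z) 0 k + b z * coordC (G z) 0 k = 0
    & exists2 z, D z & a z != 0 \/ b z != 0].
Proof.
move=> cD oO conO [z0 Dz0] sF hF sG hG; split.
  move=> minors.
  have [[k [k0 [z Dz Fz]]]|F0] := pselect (exists k : 'I_4, k != 0 /\
      exists2 z, D z & coordC (F z) 0 k != 0).
    exists (fun z => coordC (G z) 0 k), (fun z => - coordC (F z) 0 k); split.
    - exact: real_holomorphic_coord.
    - exact/real_holomorphicN/real_holomorphic_coord.
    - move=> w Dw j j0; have := minors w Dw _ _ j0 k0.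
      by rewrite mulNr mulrC => ->; rewrite subrr.
    - by exists z => //; right; rewrite oppr_eq0.
  exists (fun=> 1%:C), (fun=> 0%:C); split; try exact: real_holomorphic_cst.
  - move=> z Dz k k0; rewrite mul0r addr0 mul1r.
    by apply/eqP/negPn/negP => Fz; apply: F0; exists k; split=> //; exists z.
  - by exists z0 => //; left; exact: oner_neq0.
move=> [a [b [[da ca] [db cb] dep nz]]] z Dz i j i0 j0.
pose W z := coordC (F z) 0 i * coordC (G z) 0 j - coordC (F z) 0 j * coordC (G z) 0 i.
apply/eqP; rewrite -subr_eq0; apply/eqP; rewrite -/(W z).
have aW w : D w -> a w * W w = 0.
  move=> Dw; have ei := dep w Dw i i0; have ej := dep w Dw j j0.
  have -> : a w * W w = (a w * coordC (F w) 0 i + b w * coordC (G w) 0 i) * coordC (G w) 0 j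
      - (a w * coordC (F w) 0 j + b w * coordC (G w) 0 j) * coordC (G w) 0 i.
    by rewrite /W; ring.
  by rewrite ei ej !mul0r subrr.
have bW w : D w -> b w * W w = 0.
  move=> Dw; have ei := dep w Dw i i0; have ej := dep w Dw j j0.
  have -> : b w * W w = (a w * coordC (F w) 0 j + b w * coordC (G w) 0 j) * coordC (F w) 0 i
      - (a w * coordC (F w) 0 i + b w * coordC (G w) 0 i) * coordC (F w) 0 j.
    by rewrite /W; ring.
  by rewrite ei ej !mul0r subrr.
have dco H k w : holomorphic_on D H -> D w ->
    derivable ((fun w => coordC (H w) 0 k) : R[i]^o -> R[i]^o) w 1.
  by move=> hH Dw; exact: holomorphic_coord hH Dw.
apply: (@identity_on_circular R D W cD oO conO) Dz.
- move=> w Dw; apply: derivableB; apply: derivableM; exact: dco.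
- move=> w Dw; rewrite /W !(coordC_conj _ sF Dw) !(coordC_conj _ sG Dw).
  by rewrite -!rmorphM -rmorphB => ->; rewrite rmorph0.
have oD := circularization_plane_open cD oO.
have [w Dw [aw|bw]] := nz.
  exists [set z | D z /\ a z != 0]; first exact: nonzero_plane_open.
  split; first by exists w.
  by move=> t [Dt at0]; split=> //; have /eqP := aW t Dt; rewrite mulf_eq0 (negPf at0) => /eqP.
exists [set z | D z /\ b z != 0]; first exact: nonzero_plane_open.
split; first by exists w.
by move=> t [Dt bt0]; split=> //; have /eqP := bW t Dt; rewrite mulf_eq0 (negPf bt0) => /eqP.
Qed.

Lemma real_holomorphic_induced Omega D a : conj_invariant D ->
  Omega = circularization D -> real_holomorphic D a ->
  induced_by Omega (slice_fun (scalarC \o a)) D (scalarC \o a).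
Proof.
move=> cD eO [_ ca]; split=> //; split=> // z Dz /=.
by rewrite ca// /scalarC /barC /=; case: (a z) => ? ? /=; rewrite scaleNr.
Qed.

Lemma slice_preserving_slice_fun Omega D a : conj_invariant D ->
  Omega = circularization D -> real_holomorphic D a ->
  slice_preserving_regular Omega (slice_fun (scalarC \o a)).
Proof.
move=> cD eO ha; exists D, (scalarC \o a); split.
- exact: real_holomorphic_induced.
- by apply: holomorphic_scalarC; case: ha.
- by move=> z Dz; exists (Re (a z)), (Im (a z)).
Qed.

Lemma slice_preserving_stem Omega D al : conj_invariant D ->
  Omega = circularization D -> slice_preserving_regular Omega al ->
  exists2 a, real_holomorphic D a & induced_by Omega al D (scalarC \o a).
Proof.
move=> cD eO [D' [A [iA hA rA]]].
have [[cD' sA] eO' eA] := iA.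
have eD : D' = D by apply: circularization_inj => //; rewrite -eO' -eO.
subst D'; pose a z := coordC (A z) 0 0.
have AE z : D z -> A z = scalarC (a z).
  move=> /rA [x [y e]]; rewrite /a mxE e /scalarC /= !quatZ.
  by rewrite /GRing.one /= /qone !mkqE !mulr1.
exists a; first exact: real_holomorphic_coord.
have sa : stem_function D (scalarC \o a).
  by split=> // w Dw; rewrite /comp -!AE ?sA//; exact: cD.
split=> // q Oq; rewrite eA//; move: Oq; rewrite eO => -[z [I [Dz SI ->]]].
by rewrite (slice_funE sa)// (@slice_funE _ D)// /comp -AE.
Qed.

Lemma combination_vanishes Omega D f g al be F G a b :
  induced_by Omega f D F -> induced_by Omega g D G ->
  induced_by Omega al D (scalarC \o a) -> induced_by Omega be D (scalarC \o b) ->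
  vanishes_on Omega (fun q => al q * slice_vec Omega f q + be q * slice_vec Omega g q)
  <-> forall z, D z -> forall k : 'I_4, k != 0 ->
      a z * coordC (F z) 0 k + b z * coordC (G z) 0 k = 0.
Proof.
move=> fF gG [sA eO alE] [sB _ beE].
pose X z := (Re (a z) *: vec (F z).1 - Im (a z) *: vec (F z).2)
          + (Re (b z) *: vec (G z).1 - Im (b z) *: vec (G z).2).
pose Y z := (Re (a z) *: vec (F z).2 + Im (a z) *: vec (F z).1)
          + (Re (b z) *: vec (G z).2 + Im (b z) *: vec (G z).1).
have valE z I : D z -> imag_units I -> al (slice_point z I) * slice_vec Omega f (slice_point z I)
    + be (slice_point z I) * slice_vec Omega g (slice_point z I) = X z + I * Y z.
  move=> Dz SI; have Oz : Omega (slice_point z I) by rewrite eO; exists z, I.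
  rewrite alE// beE// (slice_funE sA)// (slice_funE sB)//.
  rewrite (slice_vecE fF)// (slice_vecE gG)// !scalarC_slice_mul//.
  by rewrite /X /Y [in RHS]mulrDr addrACA.
have XY z : (X z, Y z) = (0, 0) <-> forall k : 'I_4, k != 0 ->
    a z * coordC (F z) 0 k + b z * coordC (G z) 0 k = 0.
  have coE k : k != 0 -> a z * coordC (F z) 0 k + b z * coordC (G z) 0 k =
      X z 0 k +i* Y z 0 k.
    move=> k0; rewrite /X /Y !(quatD, quatN, quatZ) 2!mxE.
    case: (a z) (b z) => p q [p' q'] /=.
    by case/ord4P: k0 => ->; rewrite !mkqE; apply/eqP; rewrite eq_complex /= ?eqxx.
  split=> [[X0 Y0] k k0|h]; first by rewrite coE// X0 Y0 !quat0.
  have h0 k : k != 0 -> X z 0 k = 0 /\ Y z 0 k = 0.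
    by move=> k0; move: (h k k0); rewrite coE// => -[].
  have [[X1 Y1] [X2 Y2] [X3 Y3]] := And3 (h0 1 isT) (h0 2 isT) (h0 3 isT).
  congr pair; apply/quatP; rewrite !quat0; split=> //.
    by rewrite /X !(quatD, quatN, quatZ) !mkqE !mulr0 !(subr0, addr0).
  by rewrite /Y !(quatD, quatN, quatZ) !mkqE !mulr0 !(subr0, addr0).
split=> [v z Dz|h q].
  apply/XY/slice_value0 => I SI; rewrite -valE//; apply: v.
  by rewrite eO; exists z, I.
rewrite {1}eO => -[z [I [Dz SI ->]]]; rewrite valE//.
by apply: (slice_value0 _ _).2 SI; apply/XY/h.
Qed.

Lemma slice_preserving_vanishes Omega D al a :
  induced_by Omega al D (scalarC \o a) ->
  vanishes_on Omega al <-> forall z, D z -> a z = 0.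
Proof.
move=> [sA eO alE]; split=> [v z Dz|h q Oq].
  have /slice_value0 : forall I, imag_units I -> (scalarC (a z)).1 + I * (scalarC (a z)).2 = 0.
    move=> I SI; have Oz : Omega (slice_point z I) by rewrite eO; exists z, I.
    by rewrite -(v _ Oz) alE// (slice_funE sA).
  case: (a z) => p q [/= /eqP + /eqP].
  rewrite !scaler_eq0 !oner_eq0 !orbF => /eqP-> /eqP->.
  by [].
rewrite alE//; move: Oq; rewrite eO => -[z [I [Dz SI ->]]].
by rewrite (slice_funE sA)//= h//= /scalarC /= !scale0r mulr0 addr0.
Qed.

End Dependence.

(** * The theorem *)

Theorem proposition2p10 (R : realType) (Omega : set (quat R))
    (hOmega : circular_domain Omega) (hne : Omega !=set0)
    (f g : quat R -> quat R)
    (hf : slice_regular Omega f) (hg : slice_regular Omega g) :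
  vanishes_on Omega (slice_wedge Omega f g) <->
  (exists alpha beta : quat R -> quat R,
    [/\ slice_preserving_regular Omega alpha,
        slice_preserving_regular Omega beta,
        vanishes_on Omega (fun q => alpha q * slice_vec Omega f q
                                  + beta q * slice_vec Omega g q)
      & ~ vanishes_on Omega alpha \/ ~ vanishes_on Omega beta]).
Proof.
have [_ oO conO] := hOmega.
have [D [F [fF hF]]] := hf; have [D' [G [gG hG]]] := hg.
have [sF eO _] := fF; have [sG eO' _] := gG.
have [cD _] := sF; have [cD' _] := sG.
have eD : D' = D by apply: circularization_inj => //; rewrite -eO' -eO.
subst D'.
have D0 : D !=set0.
  by have [q] := hne; rewrite eO => -[z [I [Dz _ _]]]; exists z.
have oc : open (circularization D) by rewrite -eO.
have cc : connected (circularization D) by rewrite -eO.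
have nv al a : induced_by Omega al D (scalarC \o a) ->
    ~ vanishes_on Omega al <-> exists2 z, D z & a z != 0.
  move=> ial; rewrite (slice_preserving_vanishes ial); split.
    move=> na; apply: contrapT => no; apply: na => z Dz.
    by apply/eqP/negPn/negP => az; apply: no; exists z.
  by move=> [z Dz az] a0; move: az; rewrite a0// eqxx.
rewrite (slice_wedge_vanishes fF gG).
have -> : (forall z, D z -> Defs.mulC (F z) (G z) = Defs.mulC (G z) (F z)) <->
    (forall z, D z -> forall i j : 'I_4, i != 0 -> j != 0 ->
      coordC (F z) 0 i * coordC (G z) 0 j = coordC (F z) 0 j * coordC (G z) 0 i).
  by split=> h z Dz; apply/mulC_comm; exact: h.
rewrite (minors_vanish_iff_dependent cD oc cc D0 sF hF sG hG); split.
  move=> [a [b [ha hb dep [z Dz nz]]]].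
  have ia := real_holomorphic_induced cD eO ha.
  have ib := real_holomorphic_induced cD eO hb.
  exists (slice_fun (scalarC \o a)), (slice_fun (scalarC \o b)); split.
  - exact: slice_preserving_slice_fun eO ha.
  - exact: slice_preserving_slice_fun eO hb.
  - exact/(combination_vanishes fF gG ia ib).
  - case: nz => nz; [left; apply/(nv _ _ ia) | right; apply/(nv _ _ ib)];
    by exists z.
move=> [al [be [hal hbe dep nz]]].
have [a ha ia] := slice_preserving_stem cD eO hal.
have [b hb ib] := slice_preserving_stem cD eO hbe.
exists a, b; split=> //; first exact/(combination_vanishes fF gG ia ib).
by case: nz => [/(nv _ _ ia)|/(nv _ _ ib)] [z Dz nz]; exists z => //; [left|right].
Qed.
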